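(* For every decreasing function $F:\mathbb{R}^+\times\mathbb{R}^+\to\mathbb{R}^+$ and every $\epsilon>0$ there is a constant $\delta>0$ such that the following holds for every separable probability space $(V,\mu)$ and every self-adjoint kernel operator $M:V\times V\to\mathbb{C}$ with $\|M\|_\infty\le 1$. There is a real number $\lambda\ge\delta$ such that $M$ has a decomposition $M=S+E+R$ with the following properties: 1. $S=[M]_\lambda$; 2. $\|E\|_2\le\epsilon$; 3. $\|R\|_\square\le F(\lambda,\epsilon)$; 4. $\|S+E\|_\infty\le 1$; 5. $E$ and $R$ are self-adjoint.
   Context: $\mathbb{R}^+$ is the set of positive reals; ''decreasing'' means decreasing in each variable. For a separable probability space $(V,\mu)$, a (Hilbert–Schmidt) kernel operator is a function $M\in L_2(V\times V,\mu\times\mu)$ with complex values, acting on $L_2(V,\mu)$ by $(Mf)(x)=\int M(x,y)f(y)\,d\mu(y)$; kernels equal almost everywhere are identified. $M$ is self-adjoint if $M(x,y)=\overline{M(y,x)}$ a.e. $\|M\|_2$ and $\|M\|_\infty$ are the $L_2$ and $L_\infty$ norms of the function $M$ on $V\times V$. The cut norm is $\|M\|_\square=\sup|f^*Mg|$, the supremum over measurable $f,g:V\to\mathbb{C}$ with $\|f\|_\infty,\|g\|_\infty\le 1$, where $f^*Mg=\iint\overline{f(x)}M(x,y)g(y)\,d\mu(x)\,d\mu(y)$. A self-adjoint $M$ has a spectral decomposition $M=\sum_i\lambda_i f_if_i^*$ (convergent in $L_2$) with $\{f_i\}$ orthonormal in $L_2(V)$, $\lambda_i\in\mathbb{R}$,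 where $(ff^* )(x,y)=f(x)\overline{f(y)}$. For $\lambda\ge 0$, $[M]_\lambda=\sum_{i:\,|\lambda_i|>\lambda}\lambda_i f_if_i^*$; equivalently $[M]_\lambda=\sum_{|\tau|>\lambda}\tau P_\tau$, with $P_\tau$ the orthogonal projection onto the eigenspace of $M$ for $\tau$. *)

(* Defs.v *)
From mathcomp Require Import all_boot all_order all_algebra.
From mathcomp Require Import complex.
From mathcomp Require Import all_classical all_reals all_analysis.

Set Implicit Arguments.
Unset Strict Implicit.
Unset Printing Implicit Defensive.

Import Order.TTheory GRing.Theory Num.Theory.
Import numFieldNormedType.Exports.

Local Open Scope classical_set_scope.
Local Open Scope ring_scope.
Local Open Scope complex_scope.

Section ComplexFunctions.
Context {d : measure_display} {T : measurableType d} {R : realType}.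
Variable m : {measure set T -> \bar R}.

Definition cmeasurable (f : T -> R[i]) : Prop :=
  measurable_fun [set: T] (fun x => complex.Re (f x)) /\
  measurable_fun [set: T] (fun x => complex.Im (f x)).

Definition cnorm (p : \bar R) (f : T -> R[i]) : \bar R :=
  Lnorm m p (fun x => (ComplexField.Normc.normc (f x))%:E).

Definition in_L2 (f : T -> R[i]) : Prop :=
  cmeasurable f /\ (cnorm 2%:E f < +oo)%E.

(* Meaningful when [f] is integrable, as it is in each use below. *)
Definition cintegral (f : T -> R[i]) : R[i] :=
  (\int[m]_x complex.Re (f x)) +i* (\int[m]_x complex.Im (f x)).

Definition inner (f g : T -> R[i]) : R[i] :=
  cintegral (fun x => f x * (g x)^*%C).

End ComplexFunctions.

Section KernelOperators.
Context {d : measure_display} {V : measurableType d} {R : realType}.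
Variable mu : probability V R.

(* Separability of the measure algebra, equivalent to that of L_2(V, mu). *)
Definition separable_probability : Prop :=
  exists A : nat -> set V,
    (forall n, measurable (A n)) /\
    forall B : set V, measurable B -> forall e : R, 0 < e ->
      exists n, (mu (A n `+` B) < e%:E)%E.

(* A kernel is a representative of its class modulo a.e. equality; the
   notions below do not depend on the representative. *)
Definition kernel_operator (M : V * V -> R[i]) : Prop :=
  in_L2 (mu \x mu)%E M.

Definition kernel_eq (M N : V * V -> R[i]) : Prop :=
  {ae (mu \x mu)%E, forall z, M z = N z}.

Definition self_adjoint (M : V * V -> R[i]) : Prop :=
  kernel_eq M (fun z => (M (z.2, z.1))^*%C).

Definition norm2 (M : V * V -> R[i]) : \bar R :=
  cnorm (mu \x mu)%E 2%:E M.

Definition normoo (M : V * V -> R[i]) : \bar R :=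
  cnorm (mu \x mu)%E +oo%E M.

Definition sesquilinear (M : V * V -> R[i]) (f g : V -> R[i]) : R[i] :=
  cintegral (mu \x mu)%E (fun z => (f z.1)^*%C * M z * g z.2).

Definition cut_norm (M : V * V -> R[i]) : \bar R :=
  ereal_sup [set r | exists f g : V -> R[i],
    [/\ cmeasurable f, cmeasurable g,
        (cnorm mu +oo%E f <= 1)%E, (cnorm mu +oo%E g <= 1)%E &
        r = (ComplexField.Normc.normc (sesquilinear M f g))%:E]].

(* [N] is the sum of [lam i * f_i f_i^*] over [i] in [I], in L_2(V x V). *)
Definition rank_one_sum (I : pred nat) (lam : nat -> R) (f : nat -> V -> R[i])
    (N : V * V -> R[i]) : Prop :=
  kernel_operator N /\
  norm2 (fun z => N z -
    \sum_(0 <= i < n | I i) (lam i)%:C * (f i z.1 * (f i z.2)^*%C))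
    @[n --> \oo] --> 0%E.

(* The index set [I] lets the decomposition be finite, as it must be when
   L_2(V, mu) is finite-dimensional; [f i] is irrelevant for [i] outside [I]. *)
Definition spectral_decomposition (M : V * V -> R[i])
    (I : pred nat) (lam : nat -> R) (f : nat -> V -> R[i]) : Prop :=
  [/\ forall i, I i -> in_L2 mu (f i),
      forall i j, I i -> I j -> inner mu (f i) (f j) = (i == j)%:R &
      rank_one_sum I lam f M].

(* [S] is [M]_tau up to a.e. equality: the sum of the terms with
   |lam i| > tau in a spectral decomposition of [M]. The class of [S] does not
   depend on the decomposition. *)
Definition is_spectral_truncation (M : V * V -> R[i]) (tau : R)
    (S : V * V -> R[i]) : Prop :=
  exists (I : pred nat) (lam : nat -> R) (f : nat -> V -> R[i]),
    spectral_decomposition M I lam f /\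
    rank_one_sum (fun i => I i && (tau < `|lam i|)) lam f S.

End KernelOperators.

Definition decreasing2 {R : realType} (F : R -> R -> R) : Prop :=
  (forall (x x' y : R), 0 < x -> x <= x' -> 0 < y -> F x' y <= F x y) /\
  (forall (x y y' : R), 0 < x -> 0 < y -> y <= y' -> F x y' <= F x y).

(* Main.v *)
(** A Hermitian kernel bounded by 1 has eigenfunctions of sup norm at most
    [1/|lambda_i|], and [sum_i lambda_i^2 <= 1].  Given a scale [x], choose
    [tau <= x] small compared with [F(x, eps)], and partition [V] into boundedly
    many cells on which the boundedly many eigenfunctions with
    [|lambda_i| > tau] are almost constant.  Let [Q] be the conditional
    expectation on the cells and [B = Q M Q], so that [|B| <= 1].  The part of [M]
    above [tau] is almost unchanged by the averaging, and the part below [tau]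
    has operator norm at most [tau] before and after; hence [M - B] has small cut
    norm.  The part of [M] below some much smaller [y] is small in [L_2] after
    averaging, because [Q] has bounded rank.  Thus [B - [M]_x] is small in [L_2]
    unless the eigenvalues in [(y, x]] carry much [L_2] mass, and iterating
    [x |-> y] from [x = 1], this fails within boundedly many steps.

    The spectral theorem is obtained by a power method: by log-convexity of
    [||A^n||_2], the powers [A^(2n+1) / rho^n] are Cauchy in [L_2], hence
    uniformly because [|A D A| <= ||D||_2] pointwise when [|A| <= 1]; so no
    completeness of [L_2] is needed.  The columns of the limit yield an
    eigenfunction with [lambda^2 ||A||_2^2 >= ||A^2||_2^2]; then deflate.  The
    squares of the remainders tend to 0 in [L_2], so the remainders tend to 0
    weakly on rectangles, hence weakly, hence in [L_2]. *)

Require Import Defs.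
From mathcomp Require Import all_boot all_order all_algebra.
From mathcomp Require Import complex ring lra zify.
From mathcomp Require Import all_classical all_reals all_analysis.
From mathcomp Require Import measurable_realfun ess_sup_inf.

Set Implicit Arguments.
Unset Strict Implicit.
Unset Printing Implicit Defensive.

Import Order.TTheory GRing.Theory Num.Theory.
Import numFieldNormedType.Exports.

Local Open Scope classical_set_scope.
Local Open Scope ring_scope.
Local Open Scope complex_scope.

(** The obstacle is the bound on [S + E]: a spectral truncation of a kernel bounded by 1 need not be
    bounded by 1, while averaging on both sides preserves the bound. Hence [S + E] is an average [B]
    of the kernel, and [E] is whatever separates [B] from the truncation. Two notions of size
    compete. The cut norm is at most the operator norm, for which eigenvalues of modulus at most
    [tau] are harmless; but [E] must be small in [L_2], where many small eigenvalues add up.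
    Averaging repairs this, as [||X Q||_2 <= ||X||_op ||Q||_2] and [||Q||_2^2] is at most the number
    of cells. So the lowest scale [y] can be fixed only after the cells, and the eigenvalues between
    [y] and [x] are left to a pigeonhole argument on the sum of their squares. For [delta] to serve
    all spaces, the number of cells must not depend on [V]: they come from a mesh on the bounded
    range of the eigenfunctions, not from [V] itself. *)

Local Notation normc := ComplexField.Normc.normc.
Local Notation Re := complex.Re.
Local Notation Im := complex.Im.

(** * Bounded measurable complex functions *)

Arguments cintegral : simpl never.
Arguments inner : simpl never.

Section Normc.
Context {R : realType}.
Implicit Types z w : R[i].

Lemma normc_ge0 z : 0 <= normc z.
Proof. by case: z => a b /=; exact: sqrtr_ge0. Qed.

Lemma normcD z w : normc (z + w) <= normc z + normc w.
Proof. exact: (@le_normcD R z w). Qed.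

Lemma normcB z w : normc (z - w) <= normc z + normc w.
Proof. by rewrite (le_trans (normcD _ _))// normcN. Qed.

Lemma normc_conj z : normc z^*%C = normc z.
Proof. by case: z => a b /=; rewrite sqrrN. Qed.

Lemma normc_real (x : R) : normc x%:C = `|x|.
Proof. by rewrite /= expr0n addr0 sqrtr_sqr. Qed.

Lemma normc_sqr z : normc z ^+ 2 = Re z ^+ 2 + Im z ^+ 2.
Proof. by case: z => a b /=; rewrite sqr_sqrtr// addr_ge0// sqr_ge0. Qed.

Lemma mulcJ z : z * z^*%C = (normc z ^+ 2)%:C.
Proof.
rewrite normc_sqr; case: z => a b /=.
by apply/eqP; rewrite eq_complex/=; apply/andP; split; apply/eqP; ring.
Qed.

Lemma le_Re_normc z : `|Re z| <= normc z.
Proof.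
rewrite -[leRHS]ger0_norm ?normc_ge0// -ler_sqr ?nnegrE//.
by rewrite !real_normK ?num_real// normc_sqr lerDl sqr_ge0.
Qed.

Lemma le_Im_normc z : `|Im z| <= normc z.
Proof.
rewrite -[leRHS]ger0_norm ?normc_ge0// -ler_sqr ?nnegrE//.
by rewrite !real_normK ?num_real// normc_sqr lerDr sqr_ge0.
Qed.

Lemma normc_le z : normc z <= `|Re z| + `|Im z|.
Proof.
rewrite -ler_sqr ?nnegrE ?normc_ge0 ?addr_ge0// normc_sqr sqrrD.
rewrite !real_normK ?num_real// lerD2r lerDl mulrn_wge0// mulr_ge0.
Qed.

Lemma normc_sum (I : Type) (r : seq I) (P : pred I) (F : I -> R[i]) :
  normc (\sum_(i <- r | P i) F i) <= \sum_(i <- r | P i) normc (F i).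
Proof.
elim/big_ind2 : _ => //; first by rewrite ComplexField.Normc.normc0.
by move=> x1 x2 y1 y2 h1 h2; rewrite (le_trans (normcD _ _))// lerD.
Qed.

Lemma conjcD z w : (z + w)^*%C = z^*%C + w^*%C. Proof. exact: rmorphD. Qed.
Lemma conjcB z w : (z - w)^*%C = z^*%C - w^*%C. Proof. exact: rmorphB. Qed.
Lemma conjcM z w : (z * w)^*%C = z^*%C * w^*%C. Proof. exact: rmorphM. Qed.
Lemma conjc_sum (I : Type) (r : seq I) (P : pred I) (F : I -> R[i]) :
  (\sum_(i <- r | P i) F i)^*%C = \sum_(i <- r | P i) (F i)^*%C.
Proof. exact: rmorph_sum. Qed.
Lemma cReD z w : Re (z + w) = Re z + Re w. Proof. by case: z; case: w. Qed.
Lemma cImD z w : Im (z + w) = Im z + Im w. Proof. by case: z; case: w. Qed.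
Lemma cReN z : Re (- z) = - Re z. Proof. by case: z. Qed.
Lemma cImN z : Im (- z) = - Im z. Proof. by case: z. Qed.
Lemma cReM z w : Re (z * w) = Re z * Re w - Im z * Im w.
Proof. by case: z; case: w. Qed.
Lemma cImM z w : Im (z * w) = Re z * Im w + Im z * Re w.
Proof. by case: z => a b; case: w => c d /=; ring. Qed.
Lemma cReJ z : Re z^*%C = Re z. Proof. by case: z. Qed.
Lemma cImJ z : Im z^*%C = - Im z. Proof. by case: z. Qed.

Lemma complex_ext z w : Re z = Re w -> Im z = Im w -> z = w.
Proof. by case: z => a b; case: w => c d /= -> ->. Qed.

Definition ReImE := (cReD, cImD, cReN, cImN, cReM, cImM, cReJ, cImJ).
End Normc.

Section BoundedMeasurable.
Context {d : measure_display} {T : measurableType d} {R : realType}.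
Implicit Types f g : T -> R[i].

(** The bound holds at every point, not almost everywhere: products, sections and partial integrals
    then exist everywhere, and identities between kernels are equalities of functions. *)
Definition bm f := cmeasurable f /\ exists C : R, forall x, normc (f x) <= C.

Lemma bm_bound f : bm f -> exists2 C : R, 0 < C & forall x, normc (f x) <= C.
Proof.
move=> [_ [C hC]]; exists (`|C| + 1); first by rewrite ltr_wpDl.
by move=> x; rewrite (le_trans (hC x))// (le_trans (ler_norm C))// lerDl.
Qed.

Lemma bmD f g : bm f -> bm g -> bm (fun x => f x + g x).
Proof.
move=> [[f1 f2] [C hC]] [[g1 g2] [D hD]]; split; first split.
- by under eq_fun do rewrite cReD; exact: measurable_funD.
- by under eq_fun do rewrite cImD; exact: measurable_funD.
- by exists (C + D) => x; rewrite (le_trans (normcD _ _))// lerD.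
Qed.

Lemma bmN f : bm f -> bm (fun x => - f x).
Proof.
move=> [[f1 f2] [C hC]]; split; first split.
- by under eq_fun do rewrite cReN; exact: measurable_funN.
- by under eq_fun do rewrite cImN; exact: measurable_funN.
- by exists C => x; rewrite normcN.
Qed.

Lemma bmB f g : bm f -> bm g -> bm (fun x => f x - g x).
Proof. by move=> ? ?; apply: bmD => //; exact: bmN. Qed.

Lemma bmM f g : bm f -> bm g -> bm (fun x => f x * g x).
Proof.
move=> [[f1 f2] [C hC]] [[g1 g2] [D hD]]; split; first split.
- under eq_fun do rewrite cReM.
  by apply: measurable_funB; exact: measurable_funM.
- under eq_fun do rewrite cImM.
  by apply: measurable_funD; exact: measurable_funM.
- exists (C * D) => x.
  by rewrite ComplexField.Normc.normcM ler_pM// normc_ge0.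
Qed.

Lemma bmJ f : bm f -> bm (fun x => (f x)^*%C).
Proof.
move=> [[f1 f2] [C hC]]; split; first split.
- by under eq_fun do rewrite cReJ.
- by under eq_fun do rewrite cImJ; exact: measurable_funN.
- by exists C => x; rewrite normc_conj.
Qed.

Lemma bm_cst (c : R[i]) : bm (fun=> c).
Proof. by split; [split; exact: measurable_cst|exists (normc c)]. Qed.

Lemma bm_sum (I : Type) (r : seq I) (P : pred I) (F : I -> T -> R[i]) :
  (forall i, P i -> bm (F i)) -> bm (fun x => \sum_(i <- r | P i) F i x).
Proof.
move=> hF; elim: r => [|i r IH].
  by rewrite (_ : (fun _ => _) = fun=> 0); [exact: bm_cst|apply/funext => x; rewrite big_nil].
case: (boolP (P i)) => Pi; last first.
  by rewrite (_ : (fun _ => _) = fun x => \sum_(j <- r | P j) F j x)//;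
    apply/funext => x; rewrite big_cons (negbTE Pi).
rewrite (_ : (fun _ => _) = fun x => F i x + \sum_(j <- r | P j) F j x).
  by apply: bmD => //; exact: hF.
by apply/funext => x; rewrite big_cons Pi.
Qed.

Lemma bm_real (u : T -> R) (C : R) : measurable_fun setT u ->
  (forall x, `|u x| <= C) -> bm (fun x => (u x)%:C).
Proof.
move=> mu hu; split; first by split => //=; exact: measurable_cst.
by exists C => x; rewrite normc_real.
Qed.

Lemma bm_indic (A : set T) : measurable A -> bm (fun x => (\1_A x)%:C : R[i]).
Proof.
move=> mA; apply: (@bm_real _ 1); first exact: measurable_indic.
by move=> x; rewrite indicE; case: (_ \in _); rewrite ?normr1 ?normr0.
Qed.

Lemma bm_measurable_normc f : bm f -> measurable_fun setT (fun x => normc (f x) ^+ 2).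
Proof.
move=> [[f1 f2] _]; under eq_fun do rewrite normc_sqr.
by apply: measurable_funD; exact: measurable_funX.
Qed.

End BoundedMeasurable.

Lemma bm_comp {d d'} {T : measurableType d} {U : measurableType d'}
    {R : realType} (f : T -> R[i]) (g : U -> T) :
  measurable_fun setT g -> bm f -> bm (fun x => f (g x)).
Proof.
move=> mg [[f1 f2] [C hC]]; split; first split.
- exact: measurableT_comp f1 mg.
- exact: measurableT_comp f2 mg.
- by exists C => x.
Qed.

(** * Complex integrals, inner products and [L_2] norms *)

Section Integral.
Context {d : measure_display} {T : measurableType d} {R : realType}.
Variable m : probability T R.
Implicit Types f g : T -> R[i].

Lemma bounded_integrable (u : T -> R) (C : R) : measurable_fun setT u ->
  (forall x, `|u x| <= C) -> m.-integrable setT (EFin \o u).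
Proof.
move=> mu hu; apply: measurable_bounded_integrable => //.
  by rewrite (le_lt_trans (probability_le1 m _))// ltry.
exists C; split; first exact: num_real.
by move=> D hD x _; rewrite /= (le_trans (hu x))// ltW.
Qed.

Lemma bm_integrableRe f : bm f -> m.-integrable setT (EFin \o (fun x => Re (f x))).
Proof.
move=> [[f1 f2] [C hC]]; apply: (@bounded_integrable _ C) => // x.
exact: le_trans (le_Re_normc _) _.
Qed.

Lemma bm_integrableIm f : bm f -> m.-integrable setT (EFin \o (fun x => Im (f x))).
Proof.
move=> [[f1 f2] [C hC]]; apply: (@bounded_integrable _ C) => // x.
exact: le_trans (le_Im_normc _) _.
Qed.

Lemma bm_integrable_normc f : bm f ->
  m.-integrable setT (EFin \o (fun x => normc (f x) ^+ 2)).
Proof.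
move=> bf; have [C C0 hC] := bm_bound bf.
apply: (@bounded_integrable _ (C ^+ 2)); first exact: bm_measurable_normc.
move=> x; rewrite ger0_norm ?sqr_ge0// ler_sqr ?nnegrE ?normc_ge0//.
exact: ltW.
Qed.

Lemma eq_cint f g : f =1 g -> cintegral m f = cintegral m g.
Proof. by move=> /funext ->. Qed.

Lemma cintD f g : bm f -> bm g ->
  cintegral m (fun x => f x + g x) = cintegral m f + cintegral m g.
Proof.
move=> bf bg; rewrite /cintegral; apply: complex_ext; rewrite ReImE /=.
- rewrite -RintegralD//; last 2 first.
  exact: bm_integrableRe. exact: bm_integrableRe.
  by apply: eq_Rintegral => x _; rewrite cReD.
- rewrite -RintegralD//; last 2 first.
  exact: bm_integrableIm. exact: bm_integrableIm.
  by apply: eq_Rintegral => x _; rewrite cImD.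
Qed.

Lemma cintZ (c : R[i]) f : bm f ->
  cintegral m (fun x => c * f x) = c * cintegral m f.
Proof.
move=> bf; have iR := bm_integrableRe bf; have iI := bm_integrableIm bf.
rewrite /cintegral; apply: complex_ext; rewrite ReImE /=.
- rewrite -!RintegralZl// -RintegralB//; last 2 first.
    by have := @integrableZl _ _ _ m setT measurableT (Re c) _ iR.
    by have := @integrableZl _ _ _ m setT measurableT (Im c) _ iI.
  by apply: eq_Rintegral => x _; rewrite cReM.
- rewrite -!RintegralZl// -RintegralD//; last 2 first.
    by have := @integrableZl _ _ _ m setT measurableT (Re c) _ iI.
    by have := @integrableZl _ _ _ m setT measurableT (Im c) _ iR.
  by apply: eq_Rintegral => x _; rewrite cImM.
Qed.

Lemma cintZr (c : R[i]) f : bm f ->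
  cintegral m (fun x => f x * c) = cintegral m f * c.
Proof.
by move=> bf; rewrite mulrC -cintZ//; apply: eq_cint => x; rewrite mulrC.
Qed.

Lemma cintN f : bm f -> cintegral m (fun x => - f x) = - cintegral m f.
Proof.
by move=> bf; rewrite -mulN1r -cintZ//; apply: eq_cint => x; rewrite mulN1r.
Qed.

Lemma cintB f g : bm f -> bm g ->
  cintegral m (fun x => f x - g x) = cintegral m f - cintegral m g.
Proof. by move=> bf bg; rewrite cintD ?cintN//; exact: bmN. Qed.

Lemma cintJ f : bm f -> cintegral m (fun x => (f x)^*%C) = (cintegral m f)^*%C.
Proof.
move=> bf; rewrite /cintegral; apply: complex_ext; rewrite ReImE /=.
- by apply: eq_Rintegral => x _; rewrite cReJ.
- rewrite -mulN1r -RintegralZl//; last exact: bm_integrableIm.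
  by apply: eq_Rintegral => x _; rewrite cImJ mulN1r.
Qed.

Lemma Rintegral_cst_prob (r : R) : \int[m]_x r = r.
Proof.
rewrite Rintegral_cst// (_ : fine _ = 1) ?mulr1//.
exact: (congr1 fine (probability_setT m)).
Qed.

Lemma cint_cst (c : R[i]) : cintegral m (fun=> c) = c.
Proof.
by rewrite /cintegral; apply: complex_ext => /=; rewrite Rintegral_cst_prob.
Qed.

Lemma cint_real (u : T -> R) :
  cintegral m (fun x => (u x)%:C) = (\int[m]_x u x)%:C.
Proof.
by rewrite /cintegral; apply: complex_ext => //=; rewrite Rintegral_cst_prob.
Qed.

Lemma cint_sum (I : Type) (r : seq I) (P : pred I) (F : I -> T -> R[i]) :
  (forall i, P i -> bm (F i)) ->
  cintegral m (fun x => \sum_(i <- r | P i) F i x) =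
  \sum_(i <- r | P i) cintegral m (F i).
Proof.
move=> hF; elim: r => [|i r IH].
  by rewrite big_nil -[RHS](cint_cst 0); apply: eq_cint => x; rewrite big_nil.
rewrite big_cons; case: (boolP (P i)) => Pi; last first.
  by rewrite -IH; apply: eq_cint => x; rewrite big_cons (negbTE Pi).
rewrite -IH -cintD; [|exact: hF|exact: bm_sum].
by apply: eq_cint => x; rewrite big_cons Pi.
Qed.

Definition nsq f : R := \int[m]_x (normc (f x) ^+ 2).

Definition nrm f : R := Num.sqrt (nsq f).

Lemma nsq_ge0 f : 0 <= nsq f.
Proof. by apply: Rintegral_ge0 => x _; exact: sqr_ge0. Qed.

Lemma nrm_ge0 f : 0 <= nrm f. Proof. exact: sqrtr_ge0. Qed.

Lemma sqr_nrm f : nrm f ^+ 2 = nsq f.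
Proof. by rewrite sqr_sqrtr// nsq_ge0. Qed.

Lemma inner_nsq f : inner m f f = (nsq f)%:C.
Proof.
by rewrite -cint_real; apply: eq_cint => x; rewrite mulcJ.
Qed.

Lemma innerJ f g : bm f -> bm g -> inner m g f = (inner m f g)^*%C.
Proof.
move=> bf bg; rewrite /inner -cintJ; last by apply: bmM => //; exact: bmJ.
by apply: eq_cint => x; rewrite conjcM conjcK mulrC.
Qed.

Lemma innerDl f g h : bm f -> bm g -> bm h ->
  inner m (fun x => f x + g x) h = inner m f h + inner m g h.
Proof.
move=> bf bg bh; rewrite /inner -cintD; last 2 first.
  by apply: bmM => //; exact: bmJ.
  by apply: bmM => //; exact: bmJ.
by apply: eq_cint => x; rewrite mulrDl.
Qed.

Lemma innerBl f g h : bm f -> bm g -> bm h ->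
  inner m (fun x => f x - g x) h = inner m f h - inner m g h.
Proof.
move=> bf bg bh; rewrite /inner -cintB; last 2 first.
  by apply: bmM => //; exact: bmJ.
  by apply: bmM => //; exact: bmJ.
by apply: eq_cint => x; rewrite mulrBl.
Qed.

Lemma innerZl c f h : bm f -> bm h ->
  inner m (fun x => c * f x) h = c * inner m f h.
Proof.
move=> bf bh; rewrite /inner -cintZ; last by apply: bmM => //; exact: bmJ.
by apply: eq_cint => x; rewrite mulrA.
Qed.

Lemma innerBr f g h : bm f -> bm g -> bm h ->
  inner m h (fun x => f x - g x) = inner m h f - inner m h g.
Proof.
move=> bf bg bh; rewrite -(conjcK (inner m h _)) -innerJ//; last exact: bmB.
by rewrite innerBl// conjcB -!innerJ.
Qed.

Lemma innerZr c f h : bm f -> bm h ->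
  inner m h (fun x => c * f x) = c^*%C * inner m h f.
Proof.
move=> bf bh; rewrite -(conjcK (inner m h _)) -innerJ//; last first.
  by apply: bmM => //; exact: bm_cst.
by rewrite innerZl// conjcM -!innerJ.
Qed.

Lemma inner_suml (I : Type) (r : seq I) (P : pred I) (F : I -> T -> R[i]) h :
  (forall i, P i -> bm (F i)) -> bm h ->
  inner m (fun x => \sum_(i <- r | P i) F i x) h =
  \sum_(i <- r | P i) inner m (F i) h.
Proof.
move=> hF bh; rewrite /inner -cint_sum; last first.
  by move=> i Pi; apply: bmM; [exact: hF|exact: bmJ].
by apply: eq_cint => x; rewrite mulr_suml.
Qed.

Lemma nsqB f g : bm f -> bm g ->
  nsq (fun x => f x - g x) = nsq f + nsq g - 2 * Re (inner m f g).
Proof.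
move=> bf bg; apply: (@complexI R).
rewrite -inner_nsq innerBl ?innerBr//; last exact: bmB.
rewrite (innerJ bf bg) !inner_nsq.
by apply: complex_ext; rewrite !ReImE/=; ring.
Qed.

Lemma nsqZ c f : bm f -> nsq (fun x => c * f x) = normc c ^+ 2 * nsq f.
Proof.
move=> bf; apply: (@complexI R).
rewrite -inner_nsq innerZl ?innerZr//; last first.
  by apply: bmM => //; exact: bm_cst.
by rewrite inner_nsq mulrA mulcJ -rmorphM.
Qed.

Lemma cauchy_schwarz_sq f g : bm f -> bm g ->
  normc (inner m f g) ^+ 2 <= nsq f * nsq g.
Proof.
move=> bf bg; set c := inner m f g; set x := normc c ^+ 2.
(* The squared norm of [f - t c g] for real [t]; the factor [c] makes the cross term real. *)
have key (t : R) : 0 <= nsq f + t ^+ 2 * x * nsq g - 2 * (t * x).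
  have := nsq_ge0 (fun y => f y - (t%:C * c) * g y).
  rewrite nsqB//; last by apply: bmM => //; exact: bm_cst.
  rewrite nsqZ// ComplexField.Normc.normcM exprMn normc_real.
  rewrite real_normK ?num_real// innerZr// conjcM conjc_real -/c.
  have -> : Re (t%:C * c^*%C * c) = t * x.
    by rewrite -mulrA [_^*%C * c]mulrC mulcJ /x cReM /=; ring.
  by [].
have x0 : 0 <= x by exact: sqr_ge0.
have a0 := nsq_ge0 f; have b0 := nsq_ge0 g.
have [b1|b1] := ltP 0 (nsq g).
  have := key (nsq g)^-1.
  rewrite -(pmulr_lge0 _ b1) => h.
  have : 0 <= nsq f * nsq g - x.
    by move: h; congr (_ <= _); field; rewrite gt_eqF.
  by rewrite subr_ge0.
have b00 : nsq g = 0 by apply/eqP; rewrite eq_le b1 b0.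
rewrite b00 mulr0 leNgt; apply/negP => x1.
(* When [nsq g = 0] the expression in [key] is affine in [t], and this [t] makes it equal to -1. *)
have := key ((nsq f + 1) / (2 * x)).
rewrite b00 mulr0 addr0.
have -> : 2 * ((nsq f + 1) / (2 * x) * x) = nsq f + 1.
  by field; rewrite gt_eqF.
by move=> h; lra.
Qed.

Lemma cauchy_schwarz f g : bm f -> bm g ->
  normc (inner m f g) <= nrm f * nrm g.
Proof.
move=> bf bg; rewrite -ler_sqr ?nnegrE ?normc_ge0 ?mulr_ge0 ?nrm_ge0//.
by rewrite exprMn !sqr_nrm cauchy_schwarz_sq.
Qed.

Lemma nrmB f g : bm f -> bm g -> nrm (fun x => f x - g x) <= nrm f + nrm g.
Proof.
move=> bf bg; rewrite -ler_sqr ?nnegrE ?addr_ge0 ?nrm_ge0//.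
rewrite sqr_nrm nsqB// sqrrD !sqr_nrm.
have := cauchy_schwarz bf bg; have := le_Re_normc (inner m f g).
by rewrite ler_norml => /andP[h1 h2] h3; nra.
Qed.

Lemma nrmZ c f : bm f -> nrm (fun x => c * f x) = normc c * nrm f.
Proof.
by move=> bf; rewrite /nrm nsqZ// sqrtrM ?sqr_ge0// sqrtr_sqr ger0_norm// normc_ge0.
Qed.

Lemma nrmN f : nrm (fun x => - f x) = nrm f.
Proof. by rewrite /nrm /nsq; under eq_Rintegral do rewrite normcN. Qed.

Lemma nrmD f g : bm f -> bm g -> nrm (fun x => f x + g x) <= nrm f + nrm g.
Proof.
move=> bf bg; rewrite -(nrmN g); apply: le_trans (nrmB bf (bmN bg)).
by under [in leRHS]eq_fun do rewrite opprK.
Qed.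

Lemma nsq_cst c : nsq (fun=> c) = normc c ^+ 2.
Proof. by rewrite /nsq Rintegral_cst_prob. Qed.

Lemma nrm_sum (I : Type) (r : seq I) (P : pred I) (F : I -> T -> R[i]) :
  (forall i, P i -> bm (F i)) ->
  nrm (fun x => \sum_(i <- r | P i) F i x) <= \sum_(i <- r | P i) nrm (F i).
Proof.
move=> hF; elim: r => [|i r IH].
  rewrite big_nil (_ : (fun _ => _) = fun=> 0); last first.
    by apply/funext => x; rewrite big_nil.
  by rewrite /nrm nsq_cst ComplexField.Normc.normc0 expr0n sqrtr0.
rewrite big_cons; case: (boolP (P i)) => Pi; last first.
  rewrite (_ : (fun _ => _) = fun x => \sum_(j <- r | P j) F j x)//.
  by apply/funext => x; rewrite big_cons (negbTE Pi).
rewrite (_ : (fun _ => _) = fun x => F i x + \sum_(j <- r | P j) F j x); last first.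
  by apply/funext => x; rewrite big_cons Pi.
apply: le_trans (nrmD _ _) _ => //; [exact: hF|exact: bm_sum|].
by rewrite lerD2l.
Qed.

Lemma le_nsq f g : bm f -> bm g -> (forall x, normc (f x) <= normc (g x)) ->
  nsq f <= nsq g.
Proof.
move=> bf bg fg; apply: le_Rintegral => //; try exact: bm_integrable_normc.
by move=> x _; rewrite ler_sqr ?nnegrE ?normc_ge0.
Qed.

Lemma nrm_le f (C : R) : 0 <= C -> bm f -> (forall x, normc (f x) <= C) -> nrm f <= C.
Proof.
move=> C0 bf fC; rewrite -ler_sqr ?nnegrE ?nrm_ge0// sqr_nrm.
have -> : C ^+ 2 = nsq (fun=> C%:C) by rewrite nsq_cst normc_real ger0_norm.
apply: le_nsq => //; first exact: bm_cst.
by move=> x; rewrite normc_real ger0_norm.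
Qed.

Lemma nsq_indic (D : set T) : measurable D ->
  nsq (fun x => (\1_D x)%:C) = fine (m D).
Proof.
move=> mD; rewrite /nsq /Rintegral; congr fine.
rewrite -[m D]/(m D) -[in RHS](setIT D) -integral_indic//.
apply: eq_integral => x _; rewrite normc_real indicE.
by case: (_ \in _); rewrite ?normr1 ?normr0 ?expr1n ?expr0n.
Qed.

Lemma normc_cint f : bm f -> normc (cintegral m f) <= nrm f.
Proof.
move=> bf; have b1 := @bm_cst _ T R 1.
have := cauchy_schwarz bf b1.
rewrite /inner; under eq_cint do rewrite conjc1 mulr1.
by rewrite {2}/nrm nsq_cst ComplexField.Normc.normc1 expr1n sqrtr1 mulr1.
Qed.

Lemma normc_cint_le f (C : R) : 0 <= C -> bm f -> (forall x, normc (f x) <= C) ->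
  normc (cintegral m f) <= C.
Proof. by move=> C0 bf fC; apply: le_trans (normc_cint bf) _; exact: nrm_le. Qed.

End Integral.

(** * Fubini for bounded complex functions *)

Section Fubini.
Context {d1 d2 : measure_display} {T1 : measurableType d1}
  {T2 : measurableType d2} {R : realType}.
Variables (m1 : probability T1 R) (m2 : probability T2 R).

Section RealFubini.
Variables (u : T1 * T2 -> R) (C : R).
Hypothesis mu : measurable_fun setT u.
Hypothesis uC : forall z, `|u z| <= C.

Let iu : (m1 \x m2)%E.-integrable setT (EFin \o u).
Proof. exact: (@bounded_integrable _ _ _ (m1 \x m2)%E _ C). Qed.

Let inner2E x : (\int[m2]_y (u (x, y))%:E)%E = (\int[m2]_y u (x, y))%:E.
Proof.
rewrite /Rintegral fineK//; apply: integrable_fin_num => //.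
apply: (@bounded_integrable _ _ _ m2 (fun y => u (x, y)) C) => //.
exact: measurableT_comp mu (pair1_measurable _).
Qed.

Let inner1E y : (\int[m1]_x (u (x, y))%:E)%E = (\int[m1]_x u (x, y))%:E.
Proof.
rewrite /Rintegral fineK//; apply: integrable_fin_num => //.
apply: (@bounded_integrable _ _ _ m1 (fun x => u (x, y)) C) => //.
exact: measurableT_comp mu (pair2_measurable _).
Qed.

Lemma measurable_Rintegral2 : measurable_fun setT (fun x => \int[m2]_y u (x, y)).
Proof.
apply/measurable_EFinP; rewrite (_ : _ \o _ = fubini_F m2 (EFin \o u)).
  exact: (@measurable_fubini_F _ _ _ _ _ m1 m2 _ iu).
by apply/funext => x; rewrite /fubini_F /= inner2E.
Qed.

Lemma Rintegral_prod1 :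
  \int[(m1 \x m2)%E]_z u z = \int[m1]_x \int[m2]_y u (x, y).
Proof.
rewrite {1 2}/Rintegral -(integral12_prod_meas1 iu); congr fine.
by apply: eq_integral => x _; rewrite /fubini_F/= inner2E.
Qed.

Lemma Rintegral_prod2 :
  \int[(m1 \x m2)%E]_z u z = \int[m2]_y \int[m1]_x u (x, y).
Proof.
rewrite {1 2}/Rintegral -(integral21_prod_meas1 iu); congr fine.
by apply: eq_integral => x _; rewrite /fubini_G/= inner1E.
Qed.

End RealFubini.

Variable F : T1 * T2 -> R[i].
Hypothesis bF : bm F.

Lemma bm_cint : bm (fun x => cintegral m2 (fun y => F (x, y))).
Proof.
case: (bF) => -[f1 f2] [C hC]; split; first split.
- rewrite /cintegral/=; apply: (@measurable_Rintegral2 (fun z => Re (F z)) C) => // z.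
  exact: le_trans (le_Re_normc _) _.
- rewrite /cintegral/=; apply: (@measurable_Rintegral2 (fun z => Im (F z)) C) => // z.
  exact: le_trans (le_Im_normc _) _.
- have [D D0 hD] := bm_bound bF; exists D => x.
  apply: normc_cint_le => //; first exact: ltW.
  by apply: (bm_comp (f := F)) => //; exact: pair1_measurable.
Qed.

Lemma cint_prod1 : cintegral (m1 \x m2)%E F =
  cintegral m1 (fun x => cintegral m2 (fun y => F (x, y))).
Proof.
case: (bF) => -[f1 f2] [C hC]; rewrite /cintegral/=; apply: complex_ext => /=.
- apply: (@Rintegral_prod1 (fun z => Re (F z)) C) => // z.
  exact: le_trans (le_Re_normc _) _.
- apply: (@Rintegral_prod1 (fun z => Im (F z)) C) => // z.
  exact: le_trans (le_Im_normc _) _.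
Qed.

Lemma cint_prod2 : cintegral (m1 \x m2)%E F =
  cintegral m2 (fun y => cintegral m1 (fun x => F (x, y))).
Proof.
case: (bF) => -[f1 f2] [C hC]; rewrite /cintegral/=; apply: complex_ext => /=.
- apply: (@Rintegral_prod2 (fun z => Re (F z)) C) => // z.
  exact: le_trans (le_Re_normc _) _.
- apply: (@Rintegral_prod2 (fun z => Im (F z)) C) => // z.
  exact: le_trans (le_Im_normc _) _.
Qed.

Lemma cint_swap :
  cintegral m1 (fun x => cintegral m2 (fun y => F (x, y))) =
  cintegral m2 (fun y => cintegral m1 (fun x => F (x, y))).
Proof. by rewrite -cint_prod1 cint_prod2. Qed.

End Fubini.

(** * The algebra of bounded kernels *)

Lemma bm_fst {d1 d2} {T1 : measurableType d1} {T2 : measurableType d2}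
    {R : realType} (f : T1 -> R[i]) : bm f -> bm (fun z : T1 * T2 => f z.1).
Proof. by move=> bf; apply: bm_comp => //; exact: measurable_fst. Qed.

Lemma bm_snd {d1 d2} {T1 : measurableType d1} {T2 : measurableType d2}
    {R : realType} (f : T2 -> R[i]) : bm f -> bm (fun z : T1 * T2 => f z.2).
Proof. by move=> bf; apply: bm_comp => //; exact: measurable_snd. Qed.

Lemma bm_pair {d d1 d2} {U : measurableType d} {T1 : measurableType d1}
    {T2 : measurableType d2} {R : realType} (F : T1 * T2 -> R[i])
    (a : U -> T1) (b : U -> T2) :
  bm F -> measurable_fun setT a -> measurable_fun setT b ->
  bm (fun x => F (a x, b x)).
Proof.
by move=> bF ma mb; apply: (bm_comp (f := F)) => //; exact: measurable_fun_pair.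
Qed.

Ltac meas := first
  [ exact: measurable_fst | exact: measurable_snd | exact: measurable_cst
  | exact: measurable_id
  | exact: (measurableT_comp measurable_fst measurable_fst)
  | exact: (measurableT_comp measurable_snd measurable_fst)
  | exact: (measurableT_comp measurable_fst measurable_snd)
  | exact: (measurableT_comp measurable_snd measurable_snd) ].

Ltac bmt := repeat first
  [ assumption | exact: bm_cst
  | apply: bmM | apply: bmB | apply: bmD | apply: bmN | apply: bmJ
  | apply: bm_pair; [|meas|meas]
  | apply: bm_fst | apply: bm_snd
  | apply: bm_comp; [meas|] ].

Section Kernels.
Context {d : measure_display} {V : measurableType d} {R : realType}.
Variable mu : probability V R.
Implicit Types (A B D : V * V -> R[i]) (f g h : V -> R[i]).

Local Notation mu2 := (mu \x mu)%E.

Definition kmul A B : V * V -> R[i] :=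
  fun z => cintegral mu (fun w => A (z.1, w) * B (w, z.2)).
Definition kadj A : V * V -> R[i] := fun z => (A (z.2, z.1))^*%C.
Definition kact A f : V -> R[i] := fun x => cintegral mu (fun w => A (x, w) * f w).
Definition ktens f g : V * V -> R[i] := fun z => f z.1 * (g z.2)^*%C.

Lemma cint_swap2 (G : V -> V -> R[i]) : bm (fun p : V * V => G p.1 p.2) ->
  cintegral mu (fun x => cintegral mu (fun y => G x y)) =
  cintegral mu (fun y => cintegral mu (fun x => G x y)).
Proof. by move=> bG; rewrite (cint_swap mu mu bG). Qed.

Lemma bm_kmul A B : bm A -> bm B -> bm (kmul A B).
Proof.
move=> bA bB.
apply: (@bm_cint _ _ _ _ _ mu2 mu (fun p => A (p.1.1, p.2) * B (p.2, p.1.2))).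
by bmt.
Qed.

Lemma bm_kact A f : bm A -> bm f -> bm (kact A f).
Proof.
move=> bA bf; apply: (@bm_cint _ _ _ _ _ mu mu (fun p => A p * f p.2)); bmt.
Qed.

Lemma bm_kadj A : bm A -> bm (kadj A).
Proof. by move=> bA; rewrite /kadj; bmt. Qed.

Lemma bm_ktens f g : bm f -> bm g -> bm (ktens f g).
Proof. by move=> bf bg; rewrite /ktens; bmt. Qed.

Lemma kadjK A : kadj (kadj A) = A.
Proof. by apply/funext => -[x y]; rewrite /kadj/= conjcK. Qed.

Lemma kmulA A B D : bm A -> bm B -> bm D -> kmul (kmul A B) D = kmul A (kmul B D).
Proof.
move=> bA bB bD; apply/funext => -[x y]; rewrite /kmul/=.
transitivity (cintegral mu (fun w => cintegral mu (fun v =>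
    A (x, v) * B (v, w) * D (w, y)))).
  by apply: eq_cint => w; rewrite -cintZr//; bmt.
rewrite cint_swap2; last by bmt.
apply: eq_cint => w; rewrite -cintZ//; last by bmt.
by apply: eq_cint => v; rewrite mulrA.
Qed.

Lemma kact_mul A B f : bm A -> bm B -> bm f -> kact (kmul A B) f = kact A (kact B f).
Proof.
move=> bA bB bf; apply/funext => x; rewrite /kact/kmul/=.
transitivity (cintegral mu (fun w => cintegral mu (fun v =>
    A (x, v) * B (v, w) * f w))).
  by apply: eq_cint => w; rewrite -cintZr//; bmt.
rewrite cint_swap2; last by bmt.
apply: eq_cint => w; rewrite -cintZ//; last by bmt.
by apply: eq_cint => v; rewrite mulrA.
Qed.

Lemma kadj_mul A B : bm A -> bm B -> kadj (kmul A B) = kmul (kadj B) (kadj A).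
Proof.
move=> bA bB; apply/funext => -[x y]; rewrite /kadj/kmul -cintJ; last by bmt.
by apply: eq_cint => w; rewrite conjcM mulrC.
Qed.

Lemma kadj_tens f g : kadj (ktens f g) = ktens g f.
Proof.
by apply/funext => -[x y]; rewrite /kadj/ktens/= conjcM conjcK mulrC.
Qed.

Lemma inner_kact A f g : bm A -> bm f -> bm g ->
  inner mu (kact A f) g = inner mu f (kact (kadj A) g).
Proof.
move=> bA bf bg; rewrite /inner /kact.
transitivity (cintegral mu (fun x => cintegral mu (fun w =>
   A (x, w) * f w * (g x)^*%C))).
  by apply: eq_cint => x; rewrite -cintZr//; bmt.
rewrite cint_swap2; last by bmt.
apply: eq_cint => w; rewrite -cintJ; last by rewrite /kadj; bmt.
rewrite -cintZ; last by rewrite /kadj; bmt.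
by apply: eq_cint => v; rewrite /kadj/= conjcM conjcK; ring.
Qed.

Lemma inner2E A B : bm A -> bm B ->
  inner mu2 A B = cintegral mu (fun y =>
    inner mu (fun x => A (x, y)) (fun x => B (x, y))).
Proof. by move=> bA bB; rewrite /inner (cint_prod2 mu mu)//; bmt. Qed.

Lemma inner2E' A B : bm A -> bm B ->
  inner mu2 A B = cintegral mu (fun x =>
    inner mu (fun y => A (x, y)) (fun y => B (x, y))).
Proof. by move=> bA bB; rewrite /inner (cint_prod1 mu mu)//; bmt. Qed.

Lemma kmul_col A B y : (fun x => kmul A B (x, y)) = kact A (fun w => B (w, y)).
Proof. by []. Qed.

Lemma inner_kmull A B D : bm A -> bm B -> bm D ->
  inner mu2 (kmul A B) D = inner mu2 B (kmul (kadj A) D).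
Proof.
move=> bA bB bD; rewrite (inner2E (bm_kmul bA bB) bD).
rewrite (inner2E bB (bm_kmul (bm_kadj bA) bD)).
by apply: eq_cint => y; rewrite !kmul_col inner_kact//; bmt.
Qed.

Lemma inner_kadj A B : bm A -> bm B ->
  inner mu2 (kadj A) (kadj B) = inner mu2 B A.
Proof.
move=> bA bB; rewrite (inner2E (bm_kadj bA) (bm_kadj bB)).
rewrite (inner2E' bB bA); apply: eq_cint => y; apply: eq_cint => x.
by rewrite /kadj/= conjcK mulrC.
Qed.

Lemma kact_inner A f x : kact A f x = inner mu f (fun w => (A (x, w))^*%C).
Proof. by rewrite /kact/inner; apply: eq_cint => w; rewrite conjcK mulrC. Qed.

Lemma nsq_conj f : nsq mu (fun x => (f x)^*%C) = nsq mu f.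
Proof. by rewrite /nsq; under eq_Rintegral do rewrite normc_conj. Qed.

Lemma nsq2E A : bm A -> nsq mu2 A = \int[mu]_y nsq mu (fun x => A (x, y)).
Proof.
move=> bA; apply: (@complexI R); rewrite -inner_nsq (inner2E bA bA).
by rewrite -cint_real; apply: eq_cint => y; rewrite inner_nsq.
Qed.

Lemma nsq2E' A : bm A -> nsq mu2 A = \int[mu]_x nsq mu (fun y => A (x, y)).
Proof.
move=> bA; apply: (@complexI R); rewrite -inner_nsq (inner2E' bA bA).
by rewrite -cint_real; apply: eq_cint => y; rewrite inner_nsq.
Qed.

Lemma nsq_kadj A : bm A -> nsq mu2 (kadj A) = nsq mu2 A.
Proof.
by move=> bA; apply: (@complexI R); rewrite -!inner_nsq (inner_kadj bA bA).
Qed.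

Lemma nrm_kadj A : bm A -> nrm mu2 (kadj A) = nrm mu2 A.
Proof. by move=> bA; rewrite /nrm nsq_kadj. Qed.

(** Makes the squared column norms integrable, so that estimates on columns can be integrated.
    Measurability is that of a partial integral, the norm being an inner product. *)
Lemma measurable_nsq1 A : bm A ->
  exists2 C, (forall y, `|nsq mu (fun x => A (x, y))| <= C) &
   measurable_fun setT (fun y => nsq mu (fun x => A (x, y))).
Proof.
move=> bA; have [C C0 hC] := bm_bound bA; exists (C ^+ 2).
  move=> y; rewrite ger0_norm ?nsq_ge0// -sqr_nrm ler_sqr ?nnegrE ?nrm_ge0 ?(ltW C0)//.
  by apply: nrm_le => //; [exact: ltW|bmt].
have [[mR _] _] := bm_cint mu mu (F := fun p => A (p.2, p.1) * (A (p.2, p.1))^*%C) ltac:(by bmt).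
by apply: eq_measurable_fun mR => y _; rewrite -/(inner mu (fun x => A (x, y)) (fun x => A (x, y))) inner_nsq.
Qed.

Lemma nsq_kact_le A f : bm A -> bm f -> nsq mu (kact A f) <= nsq mu2 A * nsq mu f.
Proof.
move=> bA bf; rewrite (nsq2E' bA).
(* Rows are needed here: up to conjugation they are the columns of [kadj A]. *)
have [C hC mC] := measurable_nsq1 (bm_kadj bA).
have e x : nsq mu (fun y => kadj A (y, x)) = nsq mu (fun y => A (x, y)).
  by rewrite /kadj/= nsq_conj.
have iC : mu.-integrable setT (EFin \o (fun x => nsq mu (fun y => A (x, y)))).
  apply: (@bounded_integrable _ _ _ _ _ C).
    by apply: eq_measurable_fun mC => x _; rewrite e.
  by move=> x; rewrite -e.
rewrite -RintegralZr//; apply: le_Rintegral => //.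
- by apply: bm_integrable_normc; exact: bm_kact.
- by have := @integrableZr _ _ _ mu setT measurableT (nsq mu f) _ iC.
- move=> x _; rewrite kact_inner mulrC -(nsq_conj (fun y => A (x, y))).
  by apply: cauchy_schwarz_sq => //; bmt.
Qed.

Lemma nrm_kact_le A f : bm A -> bm f -> nrm mu (kact A f) <= nrm mu2 A * nrm mu f.
Proof.
move=> bA bf; rewrite /nrm -sqrtrM ?nsq_ge0//.
by apply: ler_wsqrtr; exact: nsq_kact_le.
Qed.

Lemma nsq_kmul_le A B : bm A -> bm B ->
  nsq mu2 (kmul A B) <= nsq mu2 A * nsq mu2 B.
Proof.
move=> bA bB; rewrite (nsq2E (bm_kmul bA bB)).
rewrite [in leRHS](nsq2E bB).
have [C hC mC] := measurable_nsq1 bB.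
have [C' hC' mC'] := measurable_nsq1 (bm_kmul bA bB).
have iC := bounded_integrable mu mC hC.
rewrite -RintegralZl//; apply: le_Rintegral => //.
- exact: bounded_integrable mC' hC'.
- by have := @integrableZl _ _ _ mu setT measurableT (nsq mu2 A) _ iC.
- by move=> y _; rewrite kmul_col nsq_kact_le//; bmt.
Qed.

Lemma kmulBl A B D : bm A -> bm B -> bm D ->
  kmul (fun z => A z - B z) D = (fun z => kmul A D z - kmul B D z).
Proof.
move=> bA bB bD; apply/funext => -[x y]; rewrite /kmul -cintB; [|by bmt|by bmt].
by apply: eq_cint => w; rewrite mulrBl.
Qed.

Lemma kmulBr A B D : bm A -> bm B -> bm D ->
  kmul D (fun z => A z - B z) = (fun z => kmul D A z - kmul D B z).
Proof.
move=> bA bB bD; apply/funext => -[x y]; rewrite /kmul -cintB; [|by bmt|by bmt].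
by apply: eq_cint => w; rewrite mulrBr.
Qed.

Lemma kmulZl c A D : bm A -> bm D ->
  kmul (fun z => c * A z) D = (fun z => c * kmul A D z).
Proof.
move=> bA bD; apply/funext => -[x y]; rewrite /kmul -cintZ; last by bmt.
by apply: eq_cint => w; rewrite mulrA.
Qed.

Lemma kmulZr c A D : bm A -> bm D ->
  kmul D (fun z => c * A z) = (fun z => c * kmul D A z).
Proof.
move=> bA bD; apply/funext => -[x y]; rewrite /kmul -cintZ; last by bmt.
by apply: eq_cint => w; rewrite mulrCA.
Qed.

Lemma kactBl A B f : bm A -> bm B -> bm f ->
  kact (fun z => A z - B z) f = (fun z => kact A f z - kact B f z).
Proof.
move=> bA bB bD; apply/funext => x; rewrite /kact -cintB; [|by bmt|by bmt].
by apply: eq_cint => w; rewrite mulrBl.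
Qed.

Lemma kactZl c A f : bm A -> bm f ->
  kact (fun z => c * A z) f = (fun z => c * kact A f z).
Proof.
move=> bA bD; apply/funext => x; rewrite /kact -cintZ; last by bmt.
by apply: eq_cint => w; rewrite mulrA.
Qed.

Lemma kactZr c A f : bm A -> bm f ->
  kact A (fun z => c * f z) = (fun z => c * kact A f z).
Proof.
move=> bA bD; apply/funext => x; rewrite /kact -cintZ; last by bmt.
by apply: eq_cint => w; rewrite mulrCA.
Qed.

Lemma kactDr A f g : bm A -> bm f -> bm g ->
  kact A (fun z => f z + g z) = (fun z => kact A f z + kact A g z).
Proof.
move=> bA bf bg; apply/funext => x; rewrite /kact -cintD; [|by bmt|by bmt].
by apply: eq_cint => w; rewrite mulrDr.
Qed.

Lemma kact_tens f g h : bm f -> bm g -> bm h ->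
  kact (ktens f g) h = (fun x => inner mu h g * f x).
Proof.
move=> bf bg bh; apply/funext => x; rewrite /kact/ktens/inner/= -cintZr; last by bmt.
by apply: eq_cint => w; ring.
Qed.

Lemma kmul_tensl A f g : bm A -> bm f -> bm g ->
  kmul A (ktens f g) = ktens (kact A f) g.
Proof.
move=> bA bf bg; apply/funext => -[x y]; rewrite /kmul/ktens/kact/=.
by rewrite -cintZr; [|by bmt]; apply: eq_cint => w; rewrite mulrA.
Qed.

Lemma inner_tens A f g : bm A -> bm f -> bm g ->
  inner mu2 A (ktens f g) = inner mu (kact A g) f.
Proof.
move=> bA bf bg; rewrite (inner2E' bA (bm_ktens bf bg)).
rewrite [RHS]/inner/=; apply: eq_cint => x; rewrite /inner/kact -cintZr; last by bmt.
by apply: eq_cint => w; rewrite /ktens/= conjcM conjcK; ring.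
Qed.

Lemma inner_tens_tens f g h k : bm f -> bm g -> bm h -> bm k ->
  inner mu2 (ktens f g) (ktens h k) = inner mu f h * inner mu k g.
Proof.
move=> bf bg bh bk; rewrite (inner_tens (bm_ktens bf bg) bh bk).
by rewrite kact_tens// innerZl// mulrC.
Qed.

Lemma nsq_tens f g : bm f -> bm g -> nsq mu2 (ktens f g) = nsq mu f * nsq mu g.
Proof.
move=> bf bg; apply: (@complexI R).
by rewrite -inner_nsq (inner_tens_tens bf bg bf bg) !inner_nsq rmorphM.
Qed.

(** An entry of [A D B] is the inner product of [D] with the tensor of a row of [A] and a column of
    [B]. Bounded factors on both sides thus turn [L_2] smallness into uniform smallness. *)
Lemma kmul3_sup A B D (a b : R) : bm A -> bm B -> bm D -> 0 <= a -> 0 <= b ->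
  (forall z, normc (A z) <= a) -> (forall z, normc (B z) <= b) ->
  forall z, normc (kmul A (kmul D B) z) <= a * b * nrm mu2 D.
Proof.
move=> bA bB bD a0 b0 hA hB [x y].
pose G := ktens (fun v => (A (x, v))^*%C) (fun w => B (w, y)).
have bG : bm G by apply: bm_ktens; bmt.
have -> : kmul A (kmul D B) (x, y) = inner mu2 D G.
  rewrite inner_tens//; [|by bmt|by bmt].
  rewrite -[LHS]/(kact A (kact D (fun w => B (w, y))) x) kact_inner /inner.
  by apply: eq_cint => v.
apply: le_trans (cauchy_schwarz _ bD bG) _.
rewrite mulrC ler_wpM2r ?nrm_ge0//.
apply: nrm_le => //; first exact: mulr_ge0.
move=> [v w]; rewrite /G/ktens/= ComplexField.Normc.normcM !normc_conj.
by apply: ler_pM => //; exact: normc_ge0.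
Qed.

End Kernels.

(** * Norms of the statement *)

Lemma cmeasurable_comp {d d'} {T : measurableType d} {U : measurableType d'}
    {R : realType} (f : T -> R[i]) (g : U -> T) :
  measurable_fun setT g -> cmeasurable f -> cmeasurable (fun x => f (g x)).
Proof.
move=> mg [f1 f2]; split.
- exact: measurableT_comp f1 mg.
- exact: measurableT_comp f2 mg.
Qed.

Section Interface.
Context {d : measure_display} {T : measurableType d} {R : realType}.
Variable m : probability T R.
Implicit Types f g : T -> R[i].

Lemma cmeasurableM f g : cmeasurable f -> cmeasurable g ->
  cmeasurable (fun x => f x * g x).
Proof.
move=> [f1 f2] [g1 g2]; split.
- by under eq_fun do rewrite cReM; apply: measurable_funB; exact: measurable_funM.
- by under eq_fun do rewrite cImM; apply: measurable_funD; exact: measurable_funM.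
Qed.

Lemma cmeasurableD f g : cmeasurable f -> cmeasurable g ->
  cmeasurable (fun x => f x + g x).
Proof.
move=> [f1 f2] [g1 g2]; split.
- by under eq_fun do rewrite cReD; exact: measurable_funD.
- by under eq_fun do rewrite cImD; exact: measurable_funD.
Qed.

Lemma cmeasurableJ f : cmeasurable f -> cmeasurable (fun x => (f x)^*%C).
Proof.
move=> [f1 f2]; split.
- by under eq_fun do rewrite cReJ.
- by under eq_fun do rewrite cImJ; exact: measurable_funN.
Qed.

Lemma bm_cmeasurable f : bm f -> cmeasurable f. Proof. by case. Qed.

Lemma measurable_normc_sqr f : cmeasurable f ->
  measurable_fun setT (fun x => normc (f x) ^+ 2).
Proof.
move=> [f1 f2]; under eq_fun do rewrite normc_sqr.
by apply: measurable_funD; exact: measurable_funX.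
Qed.

Lemma cnorm2E f : cnorm m 2%:E f =
  ((\int[m]_x ((normc (f x) ^+ 2)%:E)) `^ 2^-1)%E.
Proof.
rewrite /cnorm unlock; congr (_ `^ _)%E; apply: eq_integral => x _.
by rewrite abse_EFin poweR_EFin powR_mulrn// ger0_norm// normc_ge0.
Qed.

Lemma cnorm2_bm f : bm f -> cnorm m 2%:E f = (nrm m f)%:E.
Proof.
move=> bf; rewrite cnorm2E /nrm /nsq /Rintegral.
have fin : (\int[m]_x ((normc (f x) ^+ 2)%:E))%E \is a fin_num.
  exact: (integrable_fin_num _ (bm_integrable_normc m bf)).
rewrite -[in LHS](fineK fin) poweR_EFin powR12_sqrt// fine_ge0//.
by apply: integral_ge0 => x _; rewrite lee_fin sqr_ge0.
Qed.

Lemma bm_in_L2 f : bm f -> in_L2 m f.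
Proof. by move=> bf; split; [exact: bm_cmeasurable|rewrite cnorm2_bm// ltry]. Qed.

Lemma cnorm2_ae f g : cmeasurable f -> cmeasurable g ->
  {ae m, forall x, f x = g x} -> cnorm m 2%:E f = cnorm m 2%:E g.
Proof.
move=> mf mg fg; rewrite !cnorm2E; congr (_ `^ _)%E.
apply: ae_eq_integral => //.
- by apply/measurable_EFinP; exact: measurable_normc_sqr.
- by apply/measurable_EFinP; exact: measurable_normc_sqr.
- by move: fg; apply: filterS => x -> _.
Qed.

Lemma cintegral_ae f g : cmeasurable f -> cmeasurable g ->
  {ae m, forall x, f x = g x} -> cintegral m f = cintegral m g.
Proof.
move=> [f1 f2] [g1 g2] fg; rewrite /cintegral; congr (_ +i* _).
- congr fine; apply: ae_eq_integral => //; try exact/measurable_EFinP.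
  by move: fg; apply: filterS => x -> _.
- congr fine; apply: ae_eq_integral => //; try exact/measurable_EFinP.
  by move: fg; apply: filterS => x -> _.
Qed.

Lemma cnormoo_le f (c : R) :
  (cnorm m +oo%E f <= c%:E)%E <-> {ae m, forall x, normc (f x) <= c}.
Proof.
(* The norm with exponent infinity tests whether the space has positive measure, which holds for
   total mass 1. *)
rewrite /cnorm unlock (_ : (0 < m [set: T])%E = true); last first.
  by rewrite -[m _]/(m setT) (_ : m setT = 1%E) ?lte01//; exact: probability_setT.
split.
  move=> /ess_supP; apply: filterS => x /=.
  by rewrite lee_fin ger0_norm// normc_ge0.
move=> h; apply/ess_supP; move: h; apply: filterS => x /=.
by rewrite lee_fin ger0_norm// normc_ge0.
Qed.

(** Turns an essential bound by 1 into a bound at every point. The squared modulus is a polynomial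
    in the real and imaginary parts, which makes the set visibly measurable. *)
Definition cutoff f : T -> R[i] :=
  fun x => f x * (\1_[set y | normc (f y) ^+ 2 <= 1] x)%:C.

Lemma cutoffE f x : normc (f x) <= 1 -> cutoff f x = f x.
Proof.
move=> fx; rewrite /cutoff indicE mem_set ?mulr1//=.
by rewrite -[leRHS](expr1n _ 2) ler_sqr ?nnegrE ?normc_ge0.
Qed.

Lemma cutoff_le f x : normc (cutoff f x) <= 1.
Proof.
rewrite /cutoff indicE ComplexField.Normc.normcM normc_real.
case: (boolP (x \in _)) => [|_]; last by rewrite normr0 mulr0.
rewrite inE/= normr1 mulr1 => fx.
by rewrite -ler_sqr ?nnegrE ?normc_ge0// expr1n.
Qed.

Lemma bm_cutoff f : cmeasurable f -> bm (cutoff f).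
Proof.
move=> mf; split; last by exists 1 => x; exact: cutoff_le.
apply: cmeasurableM => //; apply: bm_cmeasurable; apply: bm_indic.
rewrite (_ : [set y | _] = (fun y => normc (f y) ^+ 2) @^-1` [set` `]-oo, (1 : R)]]).
  rewrite -[X in measurable X]setTI.
  by apply: (measurable_normc_sqr mf) => //; exact: measurable_itv.
by apply/seteqP; split=> y /=; rewrite in_itv.
Qed.

Lemma cutoff_ae f : (cnorm m +oo%E f <= 1)%E -> {ae m, forall x, f x = cutoff f x}.
Proof. by move/cnormoo_le; apply: filterS => x /cutoffE ->. Qed.

End Interface.

(** * Cut norm and choice of a representative *)

Section CutNorm.
Context {d : measure_display} {V : measurableType d} {R : realType}.
Variable mu : probability V R.
Local Notation mu2 := (mu \x mu)%E.

Lemma ae_fst (P : V -> Prop) : {ae mu, forall x, P x} ->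
  {ae mu2, forall z : V * V, P z.1}.
Proof.
move=> [N [mN N0 PN]]; exists (N `*` setT); split.
- exact: measurableX.
- by rewrite product_measure1E// [X in (X * _)%E](_ : _ = 0%E) ?mul0e.
- by move=> z /= Pz; split => //; exact: PN.
Qed.

Lemma ae_snd (P : V -> Prop) : {ae mu, forall x, P x} ->
  {ae mu2, forall z : V * V, P z.2}.
Proof.
move=> [N [mN N0 PN]]; exists (setT `*` N); split.
- exact: measurableX.
- by rewrite product_measure1E// [X in (_ * X)%E](_ : _ = 0%E) ?mule0.
- by move=> z /= Pz; split => //; exact: PN.
Qed.

(** Cauchy-Schwarz absorbs the left test function, of norm at most 1. Both test functions may be cut
    off, since this changes them on null sets only. *)
Lemma cut_norm_le (K : V * V -> R[i]) (b : R) : bm K ->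
  (forall g, bm g -> (forall v, normc (g v) <= 1) -> nrm mu (kact mu K g) <= b) ->
  (cut_norm mu K <= b%:E)%E.
Proof.
move=> bK hK; apply: ge_ereal_sup => _ [f [g [mf mg f1 g1 ->]]].
rewrite lee_fin.
have bf := bm_cutoff mf; have bg := bm_cutoff mg.
have bKg := bm_kact mu bK bg.
have comp1 (h : V -> R[i]) : cmeasurable h -> cmeasurable (fun z : V * V => h z.1).
  exact: (cmeasurable_comp measurable_fst).
have comp2 (h : V -> R[i]) : cmeasurable h -> cmeasurable (fun z : V * V => h z.2).
  exact: (cmeasurable_comp measurable_snd).
have -> : sesquilinear mu K f g = inner mu2 K (ktens (cutoff f) (cutoff g)).
  apply: cintegral_ae.
  - apply: cmeasurableM; last exact: comp2.
    apply: cmeasurableM; last exact: bm_cmeasurable.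
    by apply: cmeasurableJ; exact: comp1.
  - apply: cmeasurableM; first exact: bm_cmeasurable.
    by apply: cmeasurableJ; apply: bm_cmeasurable; exact: bm_ktens.
  - have h1 := ae_fst (cutoff_ae f1); have h2 := ae_snd (cutoff_ae g1).
    apply: filterS2 h1 h2 => z e1 e2.
    suff : (f z.1)^*%C * K z * g z.2 =
        K z * (cutoff f z.1 * (cutoff g z.2)^*%C)^*%C by [].
    by rewrite conjcM conjcK -e1 -e2; ring.
rewrite (inner_tens mu bK bf bg).
apply: le_trans (cauchy_schwarz mu bKg bf) _.
apply: le_trans (_ : _ <= nrm mu (kact mu K (cutoff g)) * 1) _.
  by rewrite ler_wpM2l ?nrm_ge0//; apply: nrm_le => // v; exact: cutoff_le.
by rewrite mulr1; apply: hK => // v; exact: cutoff_le.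
Qed.

(** Averaging with the adjoint makes the kernel Hermitian at every point, and the cutoff keeps it so
    because its condition is symmetric in the two variables. Both operations change [M] on a null
    set only. *)
Lemma hermitian_bounded_version (M : V * V -> R[i]) :
  kernel_operator mu M -> self_adjoint mu M -> (normoo mu M <= 1)%E ->
  exists A, [/\ bm A, kadj A = A, forall z, normc (A z) <= 1 &
    {ae mu2, forall z, M z = A z}].
Proof.
move=> [mM _] sM M1.
pose N z := (2^-1 : R)%:C * (M z + kadj M z).
have swapM : cmeasurable (fun z : V * V => M (z.2, z.1)).
  apply: (cmeasurable_comp _ mM).
  by apply: measurable_fun_pair; [exact: measurable_snd|exact: measurable_fst].
have mN : cmeasurable N.
  apply: cmeasurableM; first exact: bm_cmeasurable (bm_cst _).
  by apply: cmeasurableD => //; exact: cmeasurableJ.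
have NJ x y : N (x, y) = (N (y, x))^*%C.
  by rewrite /N /kadj conjcM conjc_real conjcD conjcK addrC.
exists (cutoff N); split.
- exact: bm_cutoff.
- apply/funext => -[x y]; rewrite /kadj/cutoff conjcM conjc_real -NJ.
  congr (_ * (_)%:C); rewrite !indicE.
  have e : ((y, x) \in [set z | normc (N z) ^+ 2 <= 1]) =
           ((x, y) \in [set z | normc (N z) ^+ 2 <= 1]).
    apply/idP/idP; rewrite !inE/=.
      by rewrite NJ normc_conj.
    by rewrite NJ normc_conj.
  by rewrite e.
- exact: cutoff_le.
- have h1 := (@cnormoo_le _ _ _ mu2 M 1).1 M1.
  apply: filterS2 sM h1 => z e1 e2.
  have eN : N z = M z.
    rewrite /N /kadj -e1 -mulr2n mulrnAr -mulrnAl -rmorphMn -[2^-1 *+ 2]mulr_natr.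
    by rewrite mulVf ?pnatr_eq0// rmorph1 mul1r.
  by rewrite cutoffE eN.
Qed.

Lemma kernel_of_bm (K : V * V -> R[i]) : bm K -> kernel_operator mu K.
Proof. exact: bm_in_L2. Qed.

Lemma norm2_bm (K : V * V -> R[i]) : bm K -> norm2 mu K = (nrm mu2 K)%:E.
Proof. exact: cnorm2_bm. Qed.

Lemma norm2_cvg0 (K : nat -> V * V -> R[i]) : (forall n, bm (K n)) ->
  (forall e, 0 < e -> exists N, forall n, (N <= n)%N -> nrm mu2 (K n) <= e) ->
  norm2 mu (K n) @[n --> \oo] --> 0%E.
Proof.
move=> bK hK; under eq_fun do rewrite norm2_bm//.
apply: cvg_EFin; first exact: nearW.
apply/cvgrPdist_le => e e0; have [N hN] := hK e e0.
by exists N => // n /hN; rewrite /= sub0r normrN ger0_norm// nrm_ge0.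
Qed.

Lemma self_adjoint_of_kadj (K : V * V -> R[i]) : kadj K = K -> self_adjoint mu K.
Proof. by move=> sK; apply: aeW => z; rewrite -{1}sK. Qed.

End CutNorm.

#[local] Opaque nsq nrm.

(** * Spectral decomposition *)

Section LogConvex.
Context {R : realType}.
Variable t : nat -> R.
Hypothesis t_gt0 : forall k, 0 < t k.
Hypothesis t_convex : forall k, t k.+1 ^+ 2 <= t k * t k.+2.
Hypothesis t_submul : forall a b, t (a + b).+1 <= t a * t b.

Let r k := t k.+1 / t k.

Let r_gt0 k : 0 < r k. Proof. exact: divr_gt0. Qed.

Let r_mono : nondecreasing_seq r.
Proof.
apply/nondecreasing_seqP => k; rewrite /r ler_pdivrMr// mulrAC ler_pdivlMr//.
by rewrite -expr2 mulrC t_convex.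
Qed.

Let r_ub k : r k <= t 0.
Proof. by rewrite /r ler_pdivrMr// mulrC -{1}(addn0 k) t_submul. Qed.

Let geometric_lower j i : t j * r j ^+ i <= t (j + i)%N.
Proof.
elim: i => [|i IH]; first by rewrite expr0 mulr1 addn0.
rewrite exprSr mulrA addnS; apply: le_trans (_ : _ <= t (j + i)%N * r j) _.
  by rewrite ler_wpM2r// ltW.
apply: le_trans (_ : _ <= t (j + i)%N * r (j + i)%N) _.
  by rewrite ler_wpM2l ?(ltW (t_gt0 _))//; apply: r_mono; rewrite leq_addr.
by rewrite /r mulrC divfK// gt_eqF.
Qed.

(** In the application [t k] is [||A^(k+1)||_2^2]; index [(n+1) k + n] is therefore the power
    [(n+1)(k+1)], that is, [k+1] factors of index [n]. *)
Let power_upper n k : t (n.+1 * k + n)%N <= t n ^+ k.+1.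
Proof.
elim: k => [|k IH]; first by rewrite muln0 expr1.
rewrite exprSr (_ : (n.+1 * k.+1 + n)%N = ((n.+1 * k + n) + n).+1); last first.
  by rewrite mulnS; lia.
by apply: le_trans (t_submul _ _) _; rewrite ler_wpM2r// ltW.
Qed.

(** Compares two growth rates along the indices [(n+1) k + n]: beyond [j] the ratios are at least
    [r j], while submultiplicativity gives powers of [t n]. If [t n] were smaller, the powers of [q]
    would tend to 0 and yet stay above [c]. *)
Let ratio_power_le n j : r j ^+ n.+1 <= t n.
Proof.
rewrite leNgt; apply/negP => tn.
set q := t n / r j ^+ n.+1.
have q0 : 0 < q by rewrite divr_gt0// exprn_gt0.
have q1 : q < 1 by rewrite /q ltr_pdivrMr ?mul1r// exprn_gt0.
set c := t j / r j ^+ j.+1.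
have c0 : 0 < c by rewrite divr_gt0// exprn_gt0.
have /cvgrPdist_lt /(_ _ c0) [N _ hN] := @cvg_expr R q ltac:(by rewrite ger0_norm// ltW).
pose k := maxn N j.
have := hN k.+1 (leqW (leq_maxl _ _)); rewrite /= sub0r normrN ger0_norm ?exprn_ge0 ?(ltW q0)//.
apply/negP; rewrite -leNgt.
have jk : (j <= n.+1 * k + n)%N.
  by have := leq_maxr N j; rewrite -/k; nia.
have := le_trans (geometric_lower j ((n.+1 * k + n) - j)) _.
rewrite subnKC// => /(_ _ (power_upper n k)) h.
rewrite /c /q (expr_div_n (t n)) -exprM.
rewrite ler_pdivrMr ?exprn_gt0// mulrAC ler_pdivlMr ?exprn_gt0//.
apply: le_trans (_ : t j * r j ^+ (n.+1 * k + n - j) * r j ^+ j.+1 <= _); last first.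
  by rewrite ler_wpM2r// exprn_ge0// ltW.
rewrite -mulrA -exprD ler_wpM2l ?(ltW (t_gt0 _))//.
rewrite le_eqVlt; apply/orP; left; apply/eqP; congr (_ ^+ _).
by rewrite mulnS; lia.
Qed.

(** [rho] is the limit of the increasing ratios [t (k+1) / t k]; for powers of an operator it is the
    square of the largest modulus of an eigenvalue. The normalised sequence decreases because no
    ratio exceeds [rho], and its lower bound [rho > 0] keeps the limit away from 0. *)
Lemma log_convex_growth : exists rho : R,
  [/\ 0 < rho, t 1 / t 0 <= rho,
      forall k, rho <= t k / rho ^+ k &
      cvgn (fun k => t k / rho ^+ k)].
Proof.
have rub : has_ubound (range r) by exists (t 0) => _ [k _ <-].
have cr := nondecreasing_cvgn r_mono rub.
set rho := sup (range r) in cr.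
have rle k : r k <= rho by apply: ub_le_sup => //; exists k.
have rho0 : 0 < rho by apply: lt_le_trans (r_gt0 0) (rle 0%N).
have low k : rho <= t k / rho ^+ k.
  rewrite ler_pdivlMr ?exprn_gt0// -exprS.
  have cX : (fun j => r j ^+ k.+1) @ \oo --> rho ^+ k.+1.
    exact: (continuous_cvg _ (@exprn_continuous _ k.+1 _) cr).
  rewrite -(cvg_lim _ cX)//; apply: limr_le; first by apply/cvg_ex; eexists; exact: cX.
  by apply: nearW => j; exact: ratio_power_le.
exists rho; split => //; first exact: rle.
apply: nonincreasing_is_cvgn.
  apply/nonincreasing_seqP => k.
  rewrite ler_pdivrMr ?exprn_gt0// exprSr mulrA divfK ?expf_neq0 ?gt_eqF//.
  by rewrite mulrC -ler_pdivrMr//; exact: rle.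
by exists rho => _ [k _ <-].
Qed.

End LogConvex.

(** * Uniform limits of bounded measurable functions *)

Section UniformLimit.
Context {d : measure_display} {T : measurableType d} {R : realType}.

Lemma cauchy_cvgn (u : nat -> R) :
  (forall e, 0 < e -> exists N, forall n m, (N <= n)%N -> (N <= m)%N ->
     `|u n - u m| <= e) -> cvgn u.
Proof.
move=> hu; apply/cauchy_cvgP; apply: cauchy_exP => e e0.
have [N hN] := hu (e / 2) (divr_gt0 e0 (ltr0n _ 2)).
exists (u N); exists N => // n /= nN; rewrite /ball/=.
by rewrite (le_lt_trans (hN _ _ (leqnn N) nN))// ltr_pdivrMr// ltr_pMr// ltr1n.
Qed.

Lemma uniform_limit (K : nat -> T -> R[i]) :
  (forall n, bm (K n)) ->
  (forall e, 0 < e -> exists N, forall n m, (N <= n)%N -> (N <= m)%N ->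
     forall x, normc (K n x - K m x) <= e) ->
  exists2 P, bm P & forall e, 0 < e -> exists N, forall n, (N <= n)%N ->
     forall x, normc (P x - K n x) <= e.
Proof.
move=> bK hK.
have cR x : cvgn (fun n => Re (K n x)).
  apply: cauchy_cvgn => e /hK[N hN]; exists N => n m nN mN.
  by have := hN _ _ nN mN x; apply: le_trans; rewrite -cReN -cReD le_Re_normc.
have cI x : cvgn (fun n => Im (K n x)).
  apply: cauchy_cvgn => e /hK[N hN]; exists N => n m nN mN.
  by have := hN _ _ nN mN x; apply: le_trans; rewrite -cImN -cImD le_Im_normc.
pose P x := limn (fun n => Re (K n x)) +i* limn (fun n => Im (K n x)).
have hP e : 0 < e -> exists N, forall n, (N <= n)%N ->
     forall x, normc (P x - K n x) <= e.
  move=> e0; have [N hN] := hK (e / 2) (divr_gt0 e0 (ltr0n _ 2)).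
  exists N => n nN x; apply: le_trans (normc_le _) _.
  rewrite [leRHS]splitr; apply: lerD.
    rewrite cReD cReN /=.
    have cv : (fun k => `|Re (K k x) - Re (K n x)|) @ \oo -->
        `|limn (fun k => Re (K k x)) - Re (K n x)|.
      by apply: cvg_norm; apply: cvgB; [exact: cR|exact: cvg_cst].
    rewrite -(cvg_lim _ cv)//; apply: limr_le; first by apply/cvg_ex; eexists; exact: cv.
    exists N => // k /= kN; have := hN _ _ kN nN x; apply: le_trans.
    by rewrite -cReN -cReD le_Re_normc.
  rewrite cImD cImN /=.
  have cv : (fun k => `|Im (K k x) - Im (K n x)|) @ \oo -->
      `|limn (fun k => Im (K k x)) - Im (K n x)|.
    by apply: cvg_norm; apply: cvgB; [exact: cI|exact: cvg_cst].
  rewrite -(cvg_lim _ cv)//; apply: limr_le; first by apply/cvg_ex; eexists; exact: cv.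
  exists N => // k /= kN; have := hN _ _ kN nN x; apply: le_trans.
  by rewrite -cImN -cImD le_Im_normc.
exists P => //; split; first split.
- apply: (@measurable_fun_cvg _ _ _ _ (fun n x => Re (K n x))) => //.
  by move=> n; have [[]] := bK n.
- apply: (@measurable_fun_cvg _ _ _ _ (fun n x => Im (K n x))) => //.
  by move=> n; have [[]] := bK n.
have [N hN] := hP 1 ltr01; have [_ [C hC]] := bK N.
exists (1 + C) => x; rewrite -(subrK (K N x) (P x)).
by apply: le_trans (normcD _ _) _; rewrite lerD// hN.
Qed.

End UniformLimit.

(** * Existence of a dominant eigenfunction *)

Section Eigen.
Context {d : measure_display} {V : measurableType d} {R : realType}.
Variable mu : probability V R.
Variable A : V * V -> R[i].
Hypothesis bA : bm A.
Hypothesis adjA : kadj A = A.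

Local Notation mu2 := (mu \x mu)%E.

(* Since there is no unit, [pw n] is the power [A^(n+1)]. *)
Fixpoint pw n : V * V -> R[i] := if n is k.+1 then kmul mu A (pw k) else A.

Let bpw n : bm (pw n).
Proof. by elim: n => //= n IH; exact: bm_kmul. Qed.

Let pw_add a b : kmul mu (pw a) (pw b) = pw (a + b).+1.
Proof.
elim: a => //= a IH.
by rewrite (kmulA mu bA (bpw a) (bpw b)) IH.
Qed.

Definition pw_nsq n := nsq mu2 (pw n).
Local Notation t := pw_nsq.

(** Self-adjointness moves factors [A] from the larger power to the smaller one until both are
    equal. *)
Let inner_pw j : forall a, inner mu2 (pw (a + j.*2)) (pw a) = (t (a + j))%:C.
Proof.
elim: j => [|j IH] a; first by rewrite double0 !addn0 inner_nsq.
have -> : (a + j.+1.*2 = (a.+1 + j.*2).+1)%N by rewrite doubleS !addnS addSn.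
rewrite -addSnnS -IH.
by have := inner_kmull mu bA (bpw (a.+1 + j.*2)) (bpw a); rewrite adjA.
Qed.

Let t_submul a b : t (a + b).+1 <= t a * t b.
Proof. by rewrite /pw_nsq -pw_add; exact: nsq_kmul_le. Qed.

Let tE n : nsq mu2 (pw n) = t n. Proof. by []. Qed.

Opaque pw_nsq.

(** Cauchy-Schwarz for the powers of index [k+2] and [k], whose inner product is [t (k+1)]. *)
Let t_convex k : t k.+1 ^+ 2 <= t k * t k.+2.
Proof.
have h := cauchy_schwarz_sq mu2 (bpw k.+2) (bpw k).
have e := inner_pw 1 k; rewrite addn2 addn1 in e.
rewrite e normc_real !tE real_normK ?num_real// in h.
by rewrite mulrC; exact: h.
Qed.

Hypothesis A2 : 0 < nsq mu2 (kmul mu A A).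

Let t_gt0 k : 0 < t k.
Proof.
have t1 : 0 < t 1 by [].
have t0 : 0 < t 0.
  rewrite lt_neqAle nsq_ge0 andbT; apply/eqP => t0.
  by have := t_submul 0 0; rewrite -t0 mul0r leNgt t1.
(* Log-convexity yields a positive term only from two consecutive positive ones. *)
suff /andP[] : (0 < t k) && (0 < t k.+1) by [].
elim: k => [|k /andP[tk tk1]]; first by rewrite t0 t1.
apply/andP; split; first exact: tk1.
have h := t_convex k; rewrite -(ler_pdivrMl _ _ tk) in h.
apply: lt_le_trans h; apply: mulr_gt0; first by rewrite invr_gt0.
exact: exprn_gt0.
Qed.

(* The normalised odd powers [A^(2n+1) / rho^n] converge uniformly to a kernel
   [P] whose columns are eigenfunctions of [A^2]. *)
Let square_eigenfunction : exists (rho : R) (f : V -> R[i]) (x0 : V),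
  [/\ 0 < rho, t 1 / t 0 <= rho, bm f, f x0 != 0 &
     kact mu A (kact mu A f) = (fun x => rho%:C * f x)].
Proof.
have [rho [rho0 rho1 low cu]] := log_convex_growth t_gt0 t_convex t_submul.
pose u k := t k / rho ^+ k.
(* Index [2n] is the odd power [2n+1]; multiplying by [A] on both sides leads to the next one. *)
pose B n : V * V -> R[i] := fun z => (rho ^- n)%:C * pw n.*2 z.
have bB n : bm (B n) by apply: bmM; [exact: bm_cst|exact: bpw].
have innerB n m : inner mu2 (B n) (B m) = (u (n + m)%N)%:C.
  rewrite /B (innerZl mu2 _ (bpw _) (bB m)) (innerZr mu2 _ (bpw _) (bpw _)).
  rewrite conjc_real.
  have H a b : (b <= a)%N -> inner mu2 (pw a.*2) (pw b.*2) = (t (a + b))%:C.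
    move=> ba; have := inner_pw (a - b) b.*2.
    rewrite -doubleD subnKC// => ->; congr (t _)%:C.
    by rewrite -addnn -addnA subnKC// addnC.
  have -> : inner mu2 (pw n.*2) (pw m.*2) = (t (n + m))%:C.
    have [mn|/ltnW nm] := leqP m n; first exact: H.
    by rewrite (innerJ mu2 (bpw m.*2) (bpw n.*2)) H// conjc_real addnC.
  rewrite -!rmorphM; congr (_%:C); rewrite /u exprD; field.
  by rewrite !expf_neq0 ?gt_eqF.
have nsqBn n : nsq mu2 (B n) = u (n + n)%N.
  by apply: (@complexI R); rewrite -inner_nsq innerB.
(* Since [inner (B n) (B m)] depends on [n + m] only, the squared distance is
   [u (2n) + u (2m) - 2 u (n+m)], which is small because [u] converges. *)
have cauchyB e : 0 < e -> exists N, forall n m, (N <= n)%N -> (N <= m)%N ->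
    nrm mu2 (fun z => B n z - B m z) <= e.
  move=> e0; have e1 : 0 < e ^+ 2 / 4 by rewrite divr_gt0// exprn_gt0.
  move/cvgrPdist_lt : cu => /(_ _ e1) [N _ hN]; exists N => n m nN mN.
  rewrite -ler_sqr ?nnegrE ?nrm_ge0 ?(ltW e0)// sqr_nrm.
  rewrite (nsqB mu2 (bB n) (bB m)) innerB !nsqBn /=.
  have H k : (N <= k)%N -> `|lim (u @ \oo) - u k| < e ^+ 2 / 4 by move=> /hN.
  have := H (n + n)%N (leq_trans nN (leq_addr _ _)).
  have := H (m + m)%N (leq_trans mN (leq_addr _ _)).
  have := H (n + m)%N (leq_trans nN (leq_addr _ _)).
  rewrite !ltr_norml => /andP[h1 h2] /andP[h3 h4] /andP[h5 h6].
  by lra.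
have [C C0 hC] := bm_bound bA.
have BS n : kmul mu A (kmul mu (B n) A) = (fun z => rho%:C * B n.+1 z).
  rewrite /B (kmulZl mu _ (bpw n.*2) bA) (kmulZr mu _ _ bA); last first.
    by apply: bm_kmul => //; exact: bpw.
  have -> : kmul mu A (kmul mu (pw n.*2) A) = pw (n.+1).*2.
    by rewrite doubleS [kmul mu (pw _) _](pw_add n.*2 0) addn0.
  apply/funext => z; rewrite mulrA -rmorphM; congr (_%:C * _).
  by rewrite exprS; field; rewrite expf_neq0 gt_eqF// gt_eqF.
(* [rho (B (n+1) - B (m+1))] is [B n - B m] between two factors [A], so [kmul3_sup] makes the
   convergence uniform. *)
have cauchyK e : 0 < e -> exists N, forall n m, (N <= n)%N -> (N <= m)%N ->
    forall z, normc (B n.+1 z - B m.+1 z) <= e.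
  move=> e0; have e1 : 0 < e * rho / (C * C).
    by rewrite divr_gt0// ?mulr_gt0.
  have [N hN] := cauchyB _ e1; exists N => n m nN mN z.
  have bD : bm (fun z => B n z - B m z) by exact: bmB.
  have := kmul3_sup mu bA bA bD (ltW C0) (ltW C0) hC hC z.
  rewrite (kmulBl mu (bB n) (bB m) bA) (kmulBr mu _ _ bA); last 2 first.
  - exact: bm_kmul.
  - exact: bm_kmul.
  rewrite !BS -mulrBr ComplexField.Normc.normcM normc_real gtr0_norm// => h.
  rewrite -(ler_pM2l rho0); apply: le_trans h _.
  rewrite mulrC -ler_pdivlMr ?mulr_gt0// (mulrC rho).
  exact: hN.
have [P bP hP] := uniform_limit (fun n => bB n.+1) cauchyK.
have bAP : bm (kmul mu A P) by exact: bm_kmul.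
have AAP z : kmul mu A (kmul mu A P) z = rho%:C * P z.
  apply/eqP; rewrite -subr_eq0; apply/eqP/ComplexField.Normc.eq0_normc.
  apply/eqP; rewrite eq_le normc_ge0 andbT; apply/ler_addgt0Pl => e e0.
  rewrite addr0.
  have e1 : 0 < e / (C * C + rho) by rewrite divr_gt0// addr_gt0// mulr_gt0.
  have [N hN] := hP _ e1.
  have bD : bm (fun z => P z - B N.+1 z) by exact: bmB.
  (* Applying [A] twice to [B (N+1)] gives exactly [rho B (N+2)]; only the uniform errors remain,
     multiplied by at most [C^2] and [rho]. *)
  have -> : kmul mu A (kmul mu A P) z - rho%:C * P z =
     kmul mu A (kmul mu A (fun z => P z - B N.+1 z)) z -
     rho%:C * (P z - B N.+2 z).
    rewrite (kmulBr mu bP (bB _) bA) (kmulBr mu bAP (bm_kmul mu bA (bB _)) bA).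
    rewrite (_ : kmul mu A (kmul mu A (B N.+1)) z = rho%:C * B N.+2 z); first by ring.
    rewrite /B (kmulZr mu _ (bpw _) bA) (kmulZr mu _ (bm_kmul mu bA (bpw _)) bA).
    rewrite mulrA -rmorphM (doubleS N.+1); congr (_%:C * _).
    by rewrite [in RHS]exprS; field; rewrite expf_neq0 gt_eqF// gt_eqF.
  apply: le_trans (normcB _ _) _.
  rewrite ComplexField.Normc.normcM normc_real gtr0_norm//.
  have -> : e = C * (C * (e / (C * C + rho))) + rho * (e / (C * C + rho)).
    by field; rewrite gt_eqF// addr_gt0// mulr_gt0.
  apply: lerD; last by rewrite ler_pM2l//; exact: hN.
  have ge1 : 0 <= C * (e / (C * C + rho)) by rewrite mulr_ge0// ltW.
  have step (G : V * V -> R[i]) (c : R) : 0 <= c -> bm G ->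
      (forall z, normc (G z) <= c) -> forall z, normc (kmul mu A G z) <= C * c.
    move=> c0 bG hG -[x y]; apply: normc_cint_le; rewrite ?mulr_ge0 ?(ltW C0)//.
      by bmt.
    by move=> w; rewrite ComplexField.Normc.normcM ler_pM// normc_ge0.
  apply: (step) => //; first exact: bm_kmul.
  by apply: (step) => //; [exact: ltW|exact: hN].
have [[x0 y0] Pz] : exists z, P z != 0.
  apply: contrapT => /forallNP P0.
  (* Then [e^2 <= rho / 4], which contradicts the lower bound [rho] for the squared norm of
     [B (N+1)]. *)
  pose e := Num.min 1 rho / 2.
  have e0 : 0 < e by rewrite divr_gt0// lt_min ltr01.
  have [N hN] := hP _ e0.
  have : nrm mu2 (B N.+1) <= e.
    apply: nrm_le => //; first exact: ltW.
    move=> z; have := hN N (leqnn _) z.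
    by have /negP := P0 z; rewrite negbK => /eqP ->; rewrite sub0r normcN.
  have eu : e <= 1 / 2 by rewrite ler_pM2r ?invr_gt0// ge_min lexx.
  have er : e <= rho / 2 by rewrite ler_pM2r ?invr_gt0// ge_min lexx orbT.
  have := low (N.+1 + N.+1)%N; rewrite -/(u _) -nsqBn -sqr_nrm => h1 h2.
  have h3 : nrm mu2 (B N.+1) ^+ 2 <= e ^+ 2.
    by rewrite ler_sqr ?nnegrE ?nrm_ge0 ?(ltW e0).
  have h4 : e ^+ 2 <= e * (1 / 2) by rewrite expr2 ler_wpM2l// ltW.
  have h5 : e * (1 / 2) <= rho / 2 * (1 / 2) by rewrite ler_pM2r// divr_gt0.
  have := le_trans h1 (le_trans h3 (le_trans h4 h5)).
  by rewrite leNgt -mulrA gtr_pMr// mul1r -invfM invf_lt1 ?mulr_gt0// -natrM ltr1n.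
exists rho, (fun x => P (x, y0)), x0; split => //; first by bmt.
by apply/funext => x; exact: (AAP (x, y0)).
Qed.

Lemma dominant_eigenfunction : exists (lam : R) (f : V -> R[i]),
  [/\ bm f, lam != 0, kact mu A f = (fun x => lam%:C * f x), nsq mu f = 1 &
      nsq mu2 (kmul mu A A) <= lam ^+ 2 * nsq mu2 A].
Proof.
have [rho [f [x0 [rho0 rho1 bf fx0 Aff]]]] := square_eigenfunction.
pose s := Num.sqrt rho.
have s0 : 0 < s by rewrite sqrtr_gt0.
have ss : s ^+ 2 = rho by rewrite sqr_sqrtr// ltW.
suff [lam [g [x1 [bg l2 gx1 Ag]]]] : exists (lam : R) (g : V -> R[i]) x1,
    [/\ bm g, lam ^+ 2 = rho, g x1 != 0 & kact mu A g = (fun x => lam%:C * g x)].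
  have lam0 : lam != 0 by apply: contraTneq rho0 => l0; rewrite -l2 l0 expr0n ltxx.
  (* A value at one point says nothing about the norm in general; but the eigenvalue equation holds
     at every point, so a null norm would force [lam * g x1 = 0]. *)
  have ng : 0 < nrm mu g.
    rewrite lt_neqAle nrm_ge0 andbT; apply: contra gx1 => /eqP ng.
    have := congr1 (fun h => h x1) Ag; rewrite kact_inner => e1.
    have := cauchy_schwarz mu bg (_ : bm (fun w => (A (x1, w))^*%C)).
    rewrite e1 -ng mul0r => /(_ ltac:(by bmt)) h.
    have /eqP : normc (lam%:C * g x1) = 0.
      by apply/eqP; rewrite eq_le h normc_ge0.
    rewrite ComplexField.Normc.normcM mulf_eq0 normc_real normr_eq0 (negbTE lam0)/=.
    by move=> /eqP/ComplexField.Normc.eq0_normc/eqP.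
  exists lam, (fun x => ((nrm mu g)^-1)%:C * g x); split => //.
  - by bmt.
  - rewrite (kactZr mu _ bA bg) Ag; apply/funext => x; ring.
  - rewrite nsqZ// normc_real ger0_norm ?invr_ge0 ?nrm_ge0// -sqr_nrm.
    by rewrite exprVn mulVf// expf_neq0// gt_eqF.
  - by rewrite l2 -ler_pdivrMr//; exact: (t_gt0 0).
(* From the factorisation [A^2 - s^2 = (A - s)(A + s)]: either [g = (A + s) f] is an eigenfunction
   for [s], or it vanishes and [f] is one for [-s]. *)
pose g x := kact mu A f x + s%:C * f x.
have bAf : bm (kact mu A f) by exact: bm_kact.
have bg : bm g by rewrite /g; bmt.
have [[x1 gx1]|/forallNP g0] := pselect (exists x, g x != 0).
  exists s, g, x1; split => //.
  rewrite /g (kactDr mu bA bAf) ?(kactZr mu _ bA bf) ?Aff; last by bmt.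
  by apply/funext => x; rewrite -ss rmorphXn/=; ring.
exists (- s), f, x0; split => //; first by rewrite sqrrN.
apply/funext => x; have /negP := g0 x; rewrite negbK => /eqP.
by rewrite /g => /eqP; rewrite addr_eq0 => /eqP ->; rewrite rmorphN mulNr.
Qed.

End Eigen.

(** * Partitions making finitely many functions almost constant *)

Section Quantization.
Context {R : realType}.

(** [q] is chosen before the space and the function: it counts the intervals of length [h] that
    cover the range, so it is uniform over all spaces. *)
Lemma quantize_real (b h : R) : 0 < h -> exists q : nat,
  forall (d : measure_display) (T : measurableType d) (u : T -> R),
    measurable_fun setT u -> (forall x, `|u x| <= b) ->
    exists c : T -> 'I_q.+1,
      (forall l, measurable (c @^-1` [set l])) /\
      forall x y, c x = c y -> `|u x - u y| <= h.
Proof.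
move=> h0; pose q := Num.truncn (2 * b / h); exists q => d T u mu ub.
pose v x := (u x + b) / h.
have v0 x : 0 <= v x.
  rewrite divr_ge0 ?(ltW h0)//.
  by have := ub x; rewrite ler_norml => /andP[]; rewrite -lerBlDr sub0r.
have vq x : (Num.truncn (v x) < q.+1)%N.
  rewrite ltnS; apply: le_truncn; rewrite ler_pM2r ?invr_gt0//.
  by have := ub x; rewrite ler_norml => /andP[_]; lra.
exists (fun x => Ordinal (vq x)); split=> [l|x y [exy]].
  have mv : measurable_fun setT v.
    apply: measurable_funM; last exact: measurable_cst.
    by apply: measurable_funD => //; exact: measurable_cst.
  rewrite (_ : _ @^-1` _ = v @^-1` [set` `[(l%:R : R), l.+1%:R[]); last first.
    apply/seteqP; split=> x /=.
      by move=> <-; rewrite in_itv/= truncn_itv.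
    rewrite in_itv/= => /truncn_def e; exact: val_inj.
  by rewrite -[X in measurable X]setTI; apply: mv => //; exact: measurable_itv.
have : `|v x - v y| <= 1.
  have /andP[x1 x2] := truncn_itv (v0 x); have /andP[y1 y2] := truncn_itv (v0 y).
  rewrite exy -natr1 in x1 x2; rewrite -natr1 in y2.
  by rewrite ler_norml; apply/andP; split; lra.
rewrite -mulrBl normrM normfV (gtr0_norm h0) ler_pdivrMr// mul1r.
by rewrite (_ : u x + b - (u y + b) = u x - u y)//; ring.
Qed.

(** A label records the mesh intervals of the real and imaginary parts of all the functions; [L]
    again precedes the space. *)
Lemma quantize (m : nat) (b h : R) : 0 < h -> exists L : finType,
  forall (d : measure_display) (T : measurableType d) (f : 'I_m -> T -> R[i]),
    (forall j, cmeasurable (f j)) -> (forall j x, normc (f j x) <= b) ->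
    exists c : T -> L,
      (forall l, measurable (c @^-1` [set l])) /\
      forall x y, c x = c y -> forall j, normc (f j x - f j y) <= h.
Proof.
move=> h0; have [q hq] := @quantize_real b (h / 2) (divr_gt0 h0 (ltr0n _ 2)).
exists {ffun 'I_m -> 'I_q.+1 * 'I_q.+1}%type => d T f mf fb.
have /choice[cR hR] j : exists c : T -> 'I_q.+1,
      (forall l, measurable (c @^-1` [set l])) /\
      forall x y, c x = c y -> `|Re (f j x) - Re (f j y)| <= h / 2.
  have [mR _] := mf j; apply: hq mR _ => x.
  exact: le_trans (le_Re_normc _) _.
have /choice[cI hI] j : exists c : T -> 'I_q.+1,
      (forall l, measurable (c @^-1` [set l])) /\
      forall x y, c x = c y -> `|Im (f j x) - Im (f j y)| <= h / 2.
  have [_ mI] := mf j; apply: hq mI _ => x.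
  exact: le_trans (le_Im_normc _) _.
exists (fun x => [ffun j => (cR j x, cI j x)]); split=> [l|x y /ffunP exy j].
  rewrite (_ : _ @^-1` _ = \bigcap_(j in [set: 'I_m])
      ((cR j @^-1` [set (l j).1]) `&` (cI j @^-1` [set (l j).2]))).
    apply: fin_bigcap_measurable => // j _.
    by apply: measurableI; [have [+ _] := hR j|have [+ _] := hI j]; exact.
  apply/seteqP; split=> x /=.
    by move=> <- j _ /=; rewrite ffunE.
  move=> hx; apply/ffunP => j; rewrite ffunE; have [/= -> ->] := hx j I.
  by case: (l j).
have := exy j; rewrite !ffunE => -[eR eI].
rewrite [leRHS]splitr; apply: le_trans (normc_le _) _.
apply: lerD.
- by rewrite cReD cReN; have [_ ] := hR j; exact.
- by rewrite cImD cImN; have [_ ] := hI j; exact.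
Qed.

End Quantization.

Section NullSequences.
Context {R : realType}.
Implicit Types u v : nat -> R[i].

Definition null_seq u :=
  forall e : R, 0 < e -> exists N, forall n, (N <= n)%N -> normc (u n) <= e.

Lemma null_seqD u v : null_seq u -> null_seq v -> null_seq (fun n => u n + v n).
Proof.
move=> hu hv e e0; have e2 : 0 < e / 2 by rewrite divr_gt0.
have [N hN] := hu _ e2; have [K hK] := hv _ e2.
exists (maxn N K) => n; rewrite geq_max => /andP[nN nK].
by rewrite (le_trans (normcD _ _))// [leRHS]splitr lerD// ?hN ?hK.
Qed.

Lemma null_seqZ c u : null_seq u -> null_seq (fun n => c * u n).
Proof.
move=> hu e e0; have c1 : 0 < normc c + 1 by rewrite ltr_wpDl ?normc_ge0.
have [N hN] := hu _ (divr_gt0 e0 c1); exists N => n /hN h.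
rewrite ComplexField.Normc.normcM; apply: le_trans (_ : _ <= (normc c + 1) * (e / (normc c + 1))) _.
  by rewrite ler_pM ?normc_ge0// lerDl.
by rewrite mulrC divfK// gt_eqF.
Qed.

Lemma null_seq_sum (I : Type) (r : seq I) (F : I -> nat -> R[i]) :
  (forall i, null_seq (F i)) -> null_seq (fun n => \sum_(i <- r) F i n).
Proof.
move=> hF; elim: r => [|i r IH] e e0.
  by exists 0%N => n _; rewrite big_nil ComplexField.Normc.normc0 ltW.
have [N hN] := null_seqD (hF i) IH e0.
by exists N => n /hN; rewrite big_cons.
Qed.

End NullSequences.

(** * From weak convergence on rectangles to weak convergence *)

Section WeakDensity.
Context {d : measure_display} {V : measurableType d} {R : realType}.
Variable mu : probability V R.
Local Notation mu2 := (mu \x mu)%E.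
Local Notation ind D := (fun x => (\1_D x)%:C : R[i]).
Variable H : nat -> V * V -> R[i].
Variable C : R.
Hypothesis bH : forall n, bm (H n).
Hypothesis HC : forall n, nrm mu2 (H n) <= C.
Hypothesis H_rect : forall B D, measurable B -> measurable D ->
  null_seq (fun n => inner mu2 (ind (B `*` D)) (H n)).

Let C0 : 0 <= C. Proof. exact: le_trans (nrm_ge0 _ _) (HC 0%N). Qed.

Let H_split f g h : bm f -> bm g -> bm h -> (forall z, f z = g z + h z) ->
  forall n, inner mu2 f (H n) = inner mu2 g (H n) + inner mu2 h (H n).
Proof.
move=> bf bg bh fgh n; rewrite -(innerDl mu2 bg bh (bH n)).
by congr inner; apply/funext.
Qed.

(** Rectangles form a pi-system, so it is enough that the good sets form a Dynkin class. *)
Let H_measurable D : measurable D ->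
  null_seq (fun n => inner mu2 (ind D) (H n)).
Proof.
move: D; rewrite measurable_prod_measurableType.
apply: (@dynkin_induction _ _ _ (fun D => null_seq (fun n => inner mu2 (ind D) (H n)))).
- exact: measurable_prod_measurableType.
- move=> _ _ [A1 mA1 [A2 mA2 <-]] [B1 mB1 [B2 mB2 <-]].
  exists (A1 `&` B1); first exact: measurableI.
  exists (A2 `&` B2); first exact: measurableI.
  by rewrite setXI.
- by rewrite -setXTT; exact: H_rect.
- by move=> _ [A mA [B mB <-]]; exact: H_rect.
- move=> S mS HS.
  have hT : null_seq (fun n => inner mu2 (ind [set: V * V]) (H n)).
    by rewrite -setXTT; exact: H_rect.
  have := null_seqD hT (null_seqZ (-1) HS).
  congr null_seq; apply/funext => n.
  rewrite (@H_split (ind setT) (ind S) (ind (~` S))); last 4 first.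
  + exact: bm_indic.
  + exact: bm_indic.
  + by apply: bm_indic; exact: measurableC.
  + move=> z; rewrite !indicE in_setT in_setC -rmorphD; congr (_%:C).
    by case: (z \in S); rewrite ?addr0 ?add0r.
  by ring.
- move=> F mF tF HF.
  pose G K : set (V * V) := \big[setU/set0]_(k < K) F k.
  have mG K : measurable (G K) by exact: bigsetU_measurable.
  have HG K : null_seq (fun n => inner mu2 (ind (G K)) (H n)).
    elim: K => [|K IH].
      move=> e e0; exists 0%N => n _.
      rewrite (_ : inner _ _ _ = 0) ?ComplexField.Normc.normc0 ?ltW//.
      rewrite /inner -[RHS](cint_cst mu2 0); apply: eq_cint => z.
      by rewrite /G big_ord0 indic0 rmorph0 mul0r.
    have := null_seqD IH (HF K); congr null_seq; apply/funext => n.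
    apply/esym; apply: H_split; try exact: bm_indic.
    move=> z; rewrite /G big_ord_recr /= !indicE in_setU -rmorphD; congr (_%:C).
    case: (boolP (z \in F K)) => zF; last by rewrite orbF addr0.
    case: (boolP (z \in \big[setU/set0]_(k < K) F k)) => zG; last by rewrite add0r.
    move: zG; rewrite -bigcup_mkord inE => -[k /= kK Fk].
    have kK' := tF k K I I (ex_intro _ z (conj Fk (set_mem zF))).
    by rewrite kK' ltnn in kK.
  pose D := \bigcup_k F k.
  have mD : measurable D by exact: bigcup_measurable.
  have mT K : measurable (D `\` G K) by exact: measurableD.
  (* The tails of the union decrease to the empty set. Their small measure and the uniform bound [C]
     control all [n] at once, by Cauchy-Schwarz; [C + 1] below replaces [C], which may be 0. *)
  have : mu2 \o (fun K => D `\` G K) @ \oo --> mu2 (\bigcap_K (D `\` G K)).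
    apply: nonincreasing_cvg_mu => //.
    + by rewrite (le_lt_trans (probability_le1 _ _))// ltry.
    + exact: bigcap_measurable.
    + apply/nonincreasing_seqP => K; apply/subsetPset; apply: setDS.
      by rewrite /G big_ord_recr/=; exact: subsetUl.
  have -> : \bigcap_K (D `\` G K) = set0.
    apply/seteqP; split=> // z hz; have [[k _ Fz] _] := hz 0%N I.
    have [_] := hz k.+1 I; apply.
    by rewrite /G big_ord_recr/=; right.
  rewrite measure0 => /fine_cvg /cvgrPdist_lt cT e e0.
  have e1 : 0 < (e / 2 / (C + 1)) ^+ 2.
    by rewrite exprn_gt0// !divr_gt0// ltr_wpDl.
  have [K _ /(_ K (leqnn K))] := cT _ e1.
  rewrite /= sub0r normrN => hK.
  have nK : nrm mu2 (ind (D `\` G K)) <= e / 2 / (C + 1).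
    have r0 : 0 <= e / 2 / (C + 1) by rewrite !divr_ge0 ?addr_ge0// ltW.
    rewrite -ler_sqr ?nnegrE ?nrm_ge0// sqr_nrm nsq_indic//.
    by apply: le_trans (ltW hK); exact: ler_norm.
  have [N hN] := HG K _ (divr_gt0 e0 (ltr0n R 2)).
  exists N => n nN.
  have eqn : inner mu2 (ind D) (H n) =
      inner mu2 (ind (G K)) (H n) + inner mu2 (ind (D `\` G K)) (H n).
    apply: H_split; try exact: bm_indic.
    move=> z; rewrite !indicE -rmorphD; congr (_%:C).
    have GD : G K `<=` D.
      by rewrite /G -bigcup_mkord => y [k _ Fy]; exists k.
    rewrite in_setD; case: (boolP (z \in G K)) => zG.
      by rewrite andbF addr0 (mem_set (GD _ (set_mem zG))).
    by rewrite andbT add0r.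
  suff : normc (inner mu2 (ind D) (H n)) <= e by [].
  rewrite eqn; apply: le_trans (normcD _ _) _; rewrite [leRHS]splitr; apply: lerD.
    exact: hN.
  apply: le_trans (cauchy_schwarz mu2 (bm_indic _) (bH n)) _ => //.
  apply: le_trans (_ : _ <= (e / 2 / (C + 1)) * (C + 1)) _.
    by apply: ler_pM; rewrite ?nrm_ge0// (le_trans (HC n))// lerDl.
  by rewrite divfK// gt_eqF// ltr_wpDl.
Qed.

Lemma weak_null_of_rectangles A : bm A -> null_seq (fun n => inner mu2 A (H n)).
Proof.
move=> bA e e0; have C1 : 0 < C + 1 by rewrite ltr_wpDl.
pose h := e / 2 / (C + 1).
have h0 : 0 < h by rewrite !divr_gt0.
have [b b0 hb] := bm_bound bA.
have [L hL] := @quantize R 1 b h h0.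
have [|//|c [mc hc]] := hL _ _ (fun=> A).
  by move=> _; have [] := bA.
(* A sample value on each cell. On an empty cell it is arbitrary, and multiplied by a zero
   indicator. *)
pose v l := A (xget point [set x | c x = l]).
have vc z : normc (A z - v (c z)) <= h.
  apply: hc ord0; apply/esym.
  by apply: (@xgetPex _ point [set x | c x = c z]); exists z.
pose S z := \sum_l v l * (\1_(c @^-1` [set l]) z)%:C : R[i].
have Sv z : S z = v (c z).
  rewrite /S (bigD1 (c z))//= big1 ?addr0 => [|l lc].
    by rewrite indicE mem_set// mulr1.
  rewrite indicE memNset ?mulr0//= => lc'; by rewrite lc' eqxx in lc.
have bv l : bm (fun z => v l * (\1_(c @^-1` [set l]) z)%:C).
  by apply: bmM; [exact: bm_cst|exact: bm_indic].
have bS : bm S by apply: bm_sum => l _; exact: bv.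
have nS : null_seq (fun n => inner mu2 S (H n)).
  have : null_seq (fun n => \sum_l v l * inner mu2 (ind (c @^-1` [set l])) (H n)).
    by apply: null_seq_sum => l; apply: null_seqZ; exact: H_measurable.
  congr null_seq; apply/funext => n; rewrite /S inner_suml//.
  by apply: eq_bigr => l _; rewrite innerZl//; exact: bm_indic.
have [N hN] := nS _ (divr_gt0 e0 (ltr0n R 2)); exists N => n nN.
have bD : bm (fun z => A z - S z) by exact: bmB.
rewrite (@H_split A (fun z => A z - S z) S)//; last by move=> z; rewrite subrK.
apply: le_trans (normcD _ _) _; rewrite [leRHS]splitr; apply: lerD; last exact: hN.
apply: le_trans (cauchy_schwarz mu2 bD (bH n)) _.
apply: le_trans (_ : _ <= h * (C + 1)) _; last by rewrite /h divfK// gt_eqF.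
apply: ler_pM; rewrite ?nrm_ge0// ?(le_trans (HC n)) ?lerDl//.
apply: nrm_le => //; first exact: ltW.
by move=> z; rewrite Sv.
Qed.

End WeakDensity.

(** * Deflation *)

Section Spectral.
Context {d : measure_display} {V : measurableType d} {R : realType}.
Variable mu : probability V R.
Local Notation mu2 := (mu \x mu)%E.

Definition rank_one (lam : R) (f : V -> R[i]) : V * V -> R[i] :=
  fun z => lam%:C * ktens f f z.

Lemma bm_rank_one lam f : bm f -> bm (rank_one lam f).
Proof. by move=> bf; apply: bmM; [exact: bm_cst|exact: bm_ktens]. Qed.

Lemma kadj_rank_one lam f : kadj (rank_one lam f) = rank_one lam f.
Proof.
apply/funext => z; rewrite /rank_one -[in RHS](kadj_tens f f) /kadj.
by rewrite conjcM conjc_real.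
Qed.

Lemma kact_rank_one lam f g : bm f -> bm g ->
  kact mu (rank_one lam f) g = (fun x => lam%:C * inner mu g f * f x).
Proof.
move=> bf bg; rewrite /rank_one (kactZl mu _ (bm_ktens bf bf) bg).
by rewrite (kact_tens mu bf bf bg); apply/funext => x; rewrite mulrA.
Qed.

(** The hypotheses on [A] stand under the existential so that choice gives a function on all
    kernels, which the recursion [deflate] can call. If [A^2] vanishes the pair is zero, and
    deflation changes nothing from then on. *)
Lemma top_eigenpair (A : V * V -> R[i]) : exists p : R * (V -> R[i]),
  bm A -> kadj A = A ->
  [/\ bm p.2, kact mu A p.2 = (fun x => p.1%:C * p.2 x),
      p.1 = 0 -> p.2 = cst 0, p.1 <> 0 -> nsq mu p.2 = 1 &
      nsq mu2 (kmul mu A A) <= p.1 ^+ 2 * nsq mu2 A].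
Proof.
have [A2|A2] := ltP 0 (nsq mu2 (kmul mu A A)).
  have [bA|?] := pselect (bm A); last by exists (0, cst 0).
  have [sA|?] := pselect (kadj A = A); last by exists (0, cst 0).
  have [lam [f [bf l0 Af nf A2l]]] := dominant_eigenfunction bA sA A2.
  exists (lam, f) => _ _; split => //= l1.
  by rewrite l1 eqxx in l0.
exists (0, cst 0) => bA _; split => //=.
- exact: bm_cst.
- apply/funext => x; rewrite mulr0 /kact -[RHS](cint_cst mu 0).
  by apply: eq_cint => w; rewrite mulr0.
- by rewrite expr0n mul0r.
Qed.

Let top := projT1 (choice top_eigenpair).
Let topP := projT2 (choice top_eigenpair).

Variable A : V * V -> R[i].
Hypothesis bA : bm A.
Hypothesis sA : kadj A = A.

Fixpoint deflate n : V * V -> R[i] :=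
  if n is k.+1 then
    fun z => deflate k z - rank_one (top (deflate k)).1 (top (deflate k)).2 z
  else A.

Definition eigval n := (top (deflate n)).1.
Definition eigfun n := (top (deflate n)).2.

Local Notation H := deflate.
Local Notation lam := eigval.
Local Notation f := eigfun.

Lemma bm_deflate n : bm (H n) /\ kadj (H n) = H n.
Proof.
elim: n => [//|n [bH sH]] /=.
have [bf _ _ _ _] := topP bH sH; split.
  by apply: bmB => //; exact: bm_rank_one.
apply/funext => z; rewrite /kadj conjcB; congr (_ - _).
  exact: (congr1 (fun h => h z) sH).
exact: (congr1 (fun h => h z) (kadj_rank_one _ _)).
Qed.

Let bH n : bm (H n). Proof. by have [] := bm_deflate n. Qed.
Let sH n : kadj (H n) = H n. Proof. by have [] := bm_deflate n. Qed.

Lemma bm_eigfun n : bm (f n).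
Proof. by have [] := topP (bH n) (sH n). Qed.

Let bf := bm_eigfun.
Let bT n : bm (rank_one (lam n) (f n)). Proof. exact: bm_rank_one. Qed.

Let Hf n : kact mu (H n) (f n) = (fun x => (lam n)%:C * f n x).
Proof. by have [] := topP (bH n) (sH n). Qed.

Lemma eigval0 n : lam n = 0 -> f n = cst 0.
Proof. by have [_ _ h _ _] := topP (bH n) (sH n); exact: h. Qed.

Lemma nsq_eigfun n : lam n <> 0 -> nsq mu (f n) = 1.
Proof. by have [_ _ _ h _] := topP (bH n) (sH n); exact: h. Qed.

Lemma nsq_eigfun_lam n : (lam n)%:C * inner mu (f n) (f n) = (lam n)%:C.
Proof.
have [->|/eqP l0] := eqVneq (lam n) 0; first by rewrite rmorph0 mul0r.
by rewrite inner_nsq (nsq_eigfun l0) mulr1.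
Qed.

Let nsq_HH n : nsq mu2 (kmul mu (H n) (H n)) <= lam n ^+ 2 * nsq mu2 (H n).
Proof. by have [] := topP (bH n) (sH n). Qed.

Let kact_H n g : bm g ->
  kact mu (H n.+1) g = (fun x => kact mu (H n) g x - (lam n)%:C * inner mu g (f n) * f n x).
Proof.
move=> bg; have := kactBl mu (bH n) (bT n) bg.
by rewrite (kact_rank_one (lam n) (bf n) bg).
Qed.

Let cst0_inner g : inner mu (cst 0) g = 0.
Proof.
by rewrite /inner -[RHS](cint_cst mu 0); apply: eq_cint => x; rewrite mul0r.
Qed.

(** For [i < n], self-adjointness gives [lam n <f i, f n> = <H n (f i), f n>], which is 0 by
    induction; so the new term also annihilates [f i]. *)
Let H_kills n i : (i < n)%N -> kact mu (H n) (f i) = cst 0.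
Proof.
elim: n => // n IH; rewrite ltnS leq_eqVlt => /orP[/eqP ->|ilt].
  rewrite (kact_H n (bf n)) Hf nsq_eigfun_lam.
  by apply/funext => x; rewrite subrr.
rewrite (kact_H n (bf i)) IH//.
suff -> : (lam n)%:C * inner mu (f i) (f n) = 0.
  by apply/funext => x; rewrite mul0r subr0.
rewrite -{1}(conjc_real (lam n)) -(innerZr mu (lam n)%:C (bf n) (bf i)) -Hf.
by rewrite -{1}(sH n) -(inner_kact mu (bH n) (bf i) (bf n)) IH.
Qed.

Let eigfun_orth_lt i j : (i < j)%N -> inner mu (f j) (f i) = 0.
Proof.
move=> ij; have [/eigval0 ->|l0] := eqVneq (lam j) 0; first exact: cst0_inner.
apply: (mulfI (_ : (lam j)%:C != 0)).
  by apply: contra l0 => /eqP/complexI ->.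
rewrite mulr0 -(innerZl mu _ (bf j) (bf i)) -Hf.
rewrite (inner_kact mu (bH j) (bf j) (bf i)) sH H_kills//.
by rewrite (innerJ mu (bm_cst 0) (bf j)) cst0_inner conjc0.
Qed.

Lemma eigfun_orth i j : i <> j -> inner mu (f i) (f j) = 0.
Proof.
move=> ij; have [ij'|ji|//] := ltngtP i j; last exact: eigfun_orth_lt.
by rewrite (innerJ mu (bf j) (bf i)) eigfun_orth_lt// conjc0.
Qed.

(** The subtracted terms are restored one at a time, from [H n] back to [A]; each is orthogonal to
    [f n]. *)
Lemma kact_eigfun n : kact mu A (f n) = (fun x => (lam n)%:C * f n x).
Proof.
suff : forall k, (k <= n)%N -> kact mu (H (n - k)) (f n) = (fun x => (lam n)%:C * f n x).
  by move=> /(_ n (leqnn n)); rewrite subnn.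
elim=> [|k IH] kn; first by rewrite subn0 Hf.
rewrite -{}IH; last exact: ltnW.
have e : (n - k = (n - k.+1).+1)%N by rewrite subnSK.
rewrite [in RHS]e (kact_H _ (bf n)) eigfun_orth; last by lia.
by apply/funext => x; rewrite mulr0 mul0r subr0.
Qed.

Let inner_H n i : (i < n)%N -> inner mu2 (rank_one (lam i) (f i)) (H n) = 0.
Proof.
move=> ilt; rewrite /rank_one (innerZl mu2 _ (bm_ktens (bf i) (bf i)) (bH n)).
rewrite (innerJ mu2 (bH n) (bm_ktens (bf i) (bf i))).
rewrite (inner_tens mu (bH n) (bf i) (bf i)) H_kills// cst0_inner conjc0.
by rewrite mulr0.
Qed.

Lemma deflateE n : H n = (fun z => A z - \sum_(0 <= i < n) rank_one (lam i) (f i) z).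
Proof.
elim: n => [|n IH]; first by apply/funext => z; rewrite big_nil subr0.
apply/funext => z; rewrite big_nat_recr//= opprD addrA.
by rewrite -[in RHS](congr1 (fun h => h z) IH).
Qed.

(** Pythagoras: the remainder [H (n+1)] is orthogonal to the term just subtracted. *)
Let nsq_H n : nsq mu2 (H n.+1) = nsq mu2 (H n) - lam n ^+ 2.
Proof.
apply: (@complexI R); rewrite -!inner_nsq.
have -> : inner mu2 (H n.+1) (H n.+1) = inner mu2 (H n) (H n.+1).
  by rewrite -[RHS]subr0 -(inner_H (leqnn n.+1)) -(innerBl mu2 (bH n) (bT n) (bH n.+1)).
rewrite [LHS](innerBr mu2 (bH n) (bT n) (bH n)) rmorphB inner_nsq.
congr (_ - _); rewrite /rank_one (innerZr mu2 _ (bm_ktens (bf n) (bf n)) (bH n)).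
rewrite (inner_tens mu (bH n) (bf n) (bf n)) Hf (innerZl mu _ (bf n) (bf n)).
by rewrite nsq_eigfun_lam conjc_real -rmorphM expr2.
Qed.

Lemma sum_eigval n : \sum_(0 <= i < n) lam i ^+ 2 = nsq mu2 A - nsq mu2 (H n).
Proof.
elim: n => [|n IH]; first by rewrite big_nil subrr.
by rewrite big_nat_recr//= IH nsq_H; ring.
Qed.

Lemma sum_eigval_le n : \sum_(0 <= i < n) lam i ^+ 2 <= nsq mu2 A.
Proof. by rewrite sum_eigval gerBl nsq_ge0. Qed.

Lemma eigval_null e : 0 < e -> exists N, forall n, (N <= n)%N -> `|lam n| <= e.
Proof.
move=> e0; pose u n := lam n ^+ 2.
have : cvgn (series u).
  apply: nondecreasing_is_cvgn.
    by apply/nondecreasing_seqP => n; rewrite /series/= big_nat_recr//= lerDl sqr_ge0.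
  by exists (nsq mu2 A) => _ [n _ <-]; exact: sum_eigval_le.
move/cvg_series_cvg_0/cvgrPdist_lt => /(_ (e ^+ 2) (exprn_gt0 2 e0)) [N _ hN].
exists N => n /hN; rewrite /= sub0r normrN /u ger0_norm ?sqr_ge0// => h.
by rewrite -ler_sqr ?nnegrE ?(ltW e0)// real_normK ?num_real// ltW.
Qed.

Let nrm_H n : nrm mu2 (H n) <= nrm mu2 A.
Proof.
rewrite -ler_sqr ?nnegrE ?nrm_ge0// !sqr_nrm -subr_ge0 -sum_eigval.
by apply: sumr_ge0 => i _; exact: sqr_ge0.
Qed.

(** [||H g||^2 = <g, H^2 g>] is at most [||H^2||_2], which the choice of the eigenpair bounds by
    [|lam n| ||H||_2]. As [lam n] tends to 0, so does the operator norm of [H n]. *)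
Let nsq_kact_H n g : bm g -> nrm mu g <= 1 ->
  nsq mu (kact mu (H n) g) <= `|lam n| * nrm mu2 A.
Proof.
move=> bg g1; have bHg := bm_kact mu (bH n) bg.
have e : (nsq mu (kact mu (H n) g))%:C =
    inner mu g (kact mu (kmul mu (H n) (H n)) g).
  rewrite -inner_nsq (inner_kact mu (bH n) bg bHg) sH.
  by rewrite (kact_mul mu (bH n) (bH n) bg).
have bHH := bm_kmul mu (bH n) (bH n).
have := cauchy_schwarz mu bg (bm_kact mu bHH bg).
rewrite -e normc_real ger0_norm ?nsq_ge0// => /le_trans; apply.
apply: le_trans (_ : _ <= 1 * nrm mu2 (kmul mu (H n) (H n))) _.
  apply: ler_pM; rewrite ?nrm_ge0//.
  apply: le_trans (nrm_kact_le mu bHH bg) _.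
  by rewrite ler_piMr ?nrm_ge0.
rewrite mul1r -ler_sqr ?nnegrE ?nrm_ge0 ?mulr_ge0 ?nrm_ge0//.
rewrite sqr_nrm exprMn real_normK ?num_real//.
apply: le_trans (nsq_HH n) _; rewrite ler_wpM2l ?sqr_ge0//.
by rewrite -sqr_nrm ler_sqr ?nnegrE ?nrm_ge0 ?nrm_H.
Qed.

Lemma deflate_null e : 0 < e ->
  exists N, forall n, (N <= n)%N -> nrm mu2 (H n) <= e.
Proof.
move=> e0.
have rect B D : measurable B -> measurable D ->
    null_seq (fun n => inner mu2 (fun z => (\1_(B `*` D) z)%:C) (H n)).
  move=> mB mD r r0.
  have bB := bm_indic (R := R) mB; have bD := bm_indic (R := R) mD.
  have n1 (S : set V) : measurable S -> nrm mu (fun x => (\1_S x)%:C) <= 1.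
    move=> mS; apply: nrm_le => //; first exact: bm_indic.
    by move=> x; rewrite normc_real indicE; case: (_ \in _); rewrite ?normr1 ?normr0.
  have a0 : 0 < nrm mu2 A + 1 by rewrite ltr_wpDl// nrm_ge0.
  have [N hN] := eigval_null (divr_gt0 (exprn_gt0 2 r0) a0).
  exists N => n nN.
  have -> : (fun z => (\1_(B `*` D) z)%:C) =
      ktens (fun x => (\1_B x)%:C) (fun x => (\1_D x)%:C) :> (V * V -> R[i]).
    apply/funext => -[x y]; rewrite /ktens conjc_real -rmorphM !indicE.
    congr (_%:C); rewrite -natrM mulnb; congr ((nat_of_bool _)%:R).
    by rewrite in_setX.
  rewrite (innerJ mu2 (bH n) (bm_ktens bB bD)) normc_conj.
  rewrite (inner_tens mu (bH n) bB bD).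
  apply: le_trans (cauchy_schwarz mu (bm_kact mu (bH n) bD) bB) _.
  apply: le_trans (_ : _ <= nrm mu (kact mu (H n) (fun x => (\1_D x)%:C)) * 1) _.
    by rewrite ler_wpM2l ?nrm_ge0 ?n1.
  rewrite mulr1 -ler_sqr ?nnegrE ?nrm_ge0 ?(ltW r0)// sqr_nrm.
  apply: le_trans (nsq_kact_H n bD (n1 _ mD)) _.
  apply: le_trans (_ : _ <= (r ^+ 2 / (nrm mu2 A + 1)) * (nrm mu2 A + 1)) _.
    by rewrite ler_pM ?nrm_ge0 ?hN// lerDl.
  by rewrite divfK// gt_eqF.
have [N hN] := weak_null_of_rectangles bH nrm_H rect bA (exprn_gt0 2 e0).
exists N => n /hN.
(* [H n] is orthogonal to every term subtracted from [A], so weak convergence tested on [A] itself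
   is norm convergence. *)
suff -> : inner mu2 A (H n) = (nsq mu2 (H n))%:C.
  rewrite normc_real ger0_norm ?nsq_ge0// -sqr_nrm => h.
  by rewrite -ler_sqr ?nnegrE ?nrm_ge0 ?(ltW e0).
rewrite -inner_nsq {2}(deflateE n).
have bS : bm (fun z => \sum_(0 <= i < n) rank_one (lam i) (f i) z).
  by apply: bm_sum => i _; exact: bT.
rewrite (innerBl mu2 bA bS (bH n)) (inner_suml mu2 _ (fun i _ => bT i) (bH n)).
rewrite big_nat_cond big1 ?subr0// => i /andP[/andP[_ ilt] _].
exact: inner_H.
Qed.

End Spectral.

(** Orthonormality concerns nonzero eigenvalues only, since deflation may pad the sequence with
    eigenvalue 0 and the zero function. *)
Definition eigensystem {d} {V : measurableType d} {R : realType}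
    (mu : probability V R) (A : V * V -> R[i]) (lam : nat -> R)
    (f : nat -> V -> R[i]) : Prop :=
  [/\ forall i, bm (f i) /\ kact mu A (f i) = (fun x => (lam i)%:C * f i x),
      forall i j, lam i != 0 -> lam j != 0 -> inner mu (f i) (f j) = (i == j)%:R,
      forall n, \sum_(0 <= i < n) lam i ^+ 2 <= nsq (mu \x mu)%E A &
      forall e, 0 < e -> exists N, forall n, (N <= n)%N ->
        nrm (mu \x mu)%E
          (fun z => A z - \sum_(0 <= i < n) rank_one (lam i) (f i) z) <= e].

Theorem bm_spectral_decomposition {d} {V : measurableType d} {R : realType}
    (mu : probability V R) (A : V * V -> R[i]) :
  bm A -> kadj A = A ->
  exists (lam : nat -> R) (f : nat -> V -> R[i]), eigensystem mu A lam f.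
Proof.
move=> bA sA; exists (eigval mu A), (eigfun mu A); split.
- by move=> i; split; [exact: bm_eigfun|exact: kact_eigfun].
- move=> i j /eqP li lj; have [<-|/eqP ij] := eqVneq i j.
    by rewrite inner_nsq nsq_eigfun.
  exact: eigfun_orth.
- exact: sum_eigval_le.
- move=> e /(deflate_null mu bA sA)[N hN]; exists N => n /hN.
  by rewrite deflateE.
Qed.

(** * Truncation and averaging *)

Section Orthonormal.
Context {d : measure_display} {T : measurableType d} {R : realType}.
Variable m : probability T R.
Variables (r : seq nat) (f : nat -> T -> R[i]).
Hypothesis ur : uniq r.
Hypothesis bf : forall i, bm (f i).
Hypothesis orth : forall i j, i \in r -> j \in r -> inner m (f i) (f j) = (i == j)%:R.

Let bcf (c : nat -> R[i]) i : bm (fun x => c i * f i x).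
Proof. by apply: bmM => //; exact: bm_cst. Qed.

Let inner_coef c i : i \in r ->
  inner m (fun x => \sum_(j <- r) c j * f j x) (f i) = c i.
Proof.
move=> ir; rewrite (inner_suml m r (fun j _ => bcf c j) (bf i)).
rewrite (bigD1_seq i)//= (innerZl m (c i) (bf i) (bf i)) orth// eqxx mulr1.
rewrite big_seq_cond big1 ?addr0// => j /andP[jr ji].
by rewrite (innerZl m (c j) (bf j) (bf i)) orth// (negbTE ji) mulr0.
Qed.

Lemma nsq_orthonormal c :
  nsq m (fun x => \sum_(j <- r) c j * f j x) = \sum_(j <- r) normc (c j) ^+ 2.
Proof.
have bS : bm (fun x => \sum_(j <- r) c j * f j x).
  by apply: bm_sum => j _; exact: bcf.
apply: (@complexI R); rewrite -inner_nsq (inner_suml m r (fun j _ => bcf c j) bS).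
rewrite rmorph_sum big_seq [RHS]big_seq; apply: eq_bigr => j jr.
rewrite (innerZl m (c j) (bf j) bS) (innerJ m bS (bf j)) inner_coef//.
exact: mulcJ.
Qed.

Lemma bessel g : bm g -> \sum_(j <- r) normc (inner m g (f j)) ^+ 2 <= nsq m g.
Proof.
move=> bg; pose c j := inner m g (f j).
have bS : bm (fun x => \sum_(j <- r) c j * f j x).
  by apply: bm_sum => j _; exact: bcf.
have := nsq_ge0 m (fun x => g x - \sum_(j <- r) c j * f j x).
rewrite (nsqB m bg bS) nsq_orthonormal (innerJ m bS bg).
rewrite (inner_suml m r (fun j _ => bcf c j) bg).
rewrite (eq_bigr (fun j => (normc (c j) ^+ 2)%:C)); last first.
  move=> j _; rewrite (innerZl m (c j) (bf j) bg) (innerJ m bg (bf j)).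
  exact: mulcJ.
rewrite -rmorph_sum conjc_real /= => h; rewrite -subr_ge0.
by apply: le_trans h _; rewrite le_eqVlt; apply/orP; left; apply/eqP; rewrite /c; ring.
Qed.

End Orthonormal.

(** * Spectral truncations and their residuals *)

Section Truncation.
Context {d : measure_display} {V : measurableType d} {R : realType}.
Variable mu : probability V R.
Local Notation mu2 := (mu \x mu)%E.

Lemma kact_sum (I : Type) (r : seq I) (P : pred I) (K : I -> V * V -> R[i]) g :
  (forall i, bm (K i)) -> bm g ->
  kact mu (fun z => \sum_(i <- r | P i) K i z) g =
  (fun x => \sum_(i <- r | P i) kact mu (K i) g x).
Proof.
move=> bK bg; apply/funext => x; rewrite /kact -cint_sum; last first.
  by move=> i _; apply: bmM => //; exact: bm_pair.
by apply: eq_cint => w; rewrite mulr_suml.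
Qed.

Lemma kmul_sumr (I : Type) (r : seq I) (P : pred I) (K : I -> V * V -> R[i]) B :
  (forall i, bm (K i)) -> bm B ->
  kmul mu B (fun z => \sum_(i <- r | P i) K i z) =
  (fun z => \sum_(i <- r | P i) kmul mu B (K i) z).
Proof.
move=> bK bB; apply/funext => z; rewrite /kmul -cint_sum; last first.
  by move=> i _; apply: bmM => //; exact: bm_pair.
by apply: eq_cint => w; rewrite mulr_sumr.
Qed.

Lemma kadj_sum (I : Type) (r : seq I) (P : pred I) (K : I -> V * V -> R[i]) :
  (forall i, kadj (K i) = K i) ->
  kadj (fun z => \sum_(i <- r | P i) K i z) = (fun z => \sum_(i <- r | P i) K i z).
Proof.
move=> sK; apply/funext => z; rewrite /kadj conjc_sum; apply: eq_bigr => i _.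
by rewrite -[in RHS]sK.
Qed.

Lemma kadjB (A B : V * V -> R[i]) : kadj A = A -> kadj B = B ->
  kadj (fun z => A z - B z) = (fun z => A z - B z).
Proof.
by move=> sA sB; apply/funext => z; rewrite /kadj conjcB -[in RHS]sA -[in RHS]sB.
Qed.

Variable A : V * V -> R[i].
Variables (lam : nat -> R) (f : nat -> V -> R[i]).
Hypothesis bA : bm A.
Hypothesis bf : forall i, bm (f i).
Hypothesis orth :
  forall i j, lam i != 0 -> lam j != 0 -> inner mu (f i) (f j) = (i == j)%:R.

Let T i := rank_one (lam i) (f i).
Let bT i : bm (T i). Proof. exact: bm_rank_one. Qed.

(** This is [[A]_tau] once [N] is beyond every eigenvalue of modulus above [tau]; being a finite
    sum, it is bounded. *)
Definition trunc (tau : R) (N : nat) : V * V -> R[i] :=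
  fun z => \sum_(0 <= i < N | tau < `|lam i|) rank_one (lam i) (f i) z.

Definition mass (tau : R) (N : nat) : R :=
  \sum_(0 <= i < N | tau < `|lam i|) lam i ^+ 2.

Lemma bm_trunc tau N : bm (trunc tau N).
Proof. by apply: bm_sum => i _; exact: bT. Qed.

Lemma kadj_trunc tau N : kadj (trunc tau N) = trunc tau N.
Proof. by apply: kadj_sum => i; exact: kadj_rank_one. Qed.

Let sum_split (W : zmodType) (G : nat -> W) (sigma tau : R) N : sigma <= tau ->
  \sum_(0 <= i < N | sigma < `|lam i|) G i - \sum_(0 <= i < N | tau < `|lam i|) G i =
  \sum_(0 <= i < N | (sigma < `|lam i|) && (`|lam i| <= tau)) G i.
Proof.
move=> st; rewrite (bigID (fun i => `|lam i| <= tau))/= -addrA.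
rewrite [X in _ + (X - _)](_ : _ = \sum_(0 <= i < N | tau < `|lam i|) G i).
  by rewrite subrr addr0.
apply: eq_bigl => i; rewrite -ltNge; apply: andb_idl; exact: le_lt_trans.
Qed.

(** The kernels [f_i f_i^*] with nonzero eigenvalue are orthonormal in [L_2(V x V)], and
    [0 <= sigma] keeps eigenvalue 0 out of the sums. *)
Lemma nsq_truncB (sigma tau : R) N : 0 <= sigma -> sigma <= tau ->
  nsq mu2 (fun z => trunc sigma N z - trunc tau N z) = mass sigma N - mass tau N.
Proof.
move=> s0 st; rewrite /mass sum_split// -big_filter.
set r := [seq i <- _ | _].
have -> : (fun z => trunc sigma N z - trunc tau N z) =
    (fun z => \sum_(i <- r) (lam i)%:C * ktens (f i) (f i) z).
  by apply/funext => z; rewrite /trunc sum_split// /r big_filter.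
have lr i : i \in r -> lam i != 0.
  by rewrite mem_filter => /andP[/andP[li _] _]; rewrite -normr_gt0 (le_lt_trans s0).
rewrite (@nsq_orthonormal _ _ _ mu2).
- by apply: eq_bigr => i _; rewrite normc_real real_normK// num_real.
- by rewrite filter_uniq// iota_uniq.
- by move=> i; exact: bm_ktens.
- move=> i j /lr li /lr lj.
  rewrite (inner_tens_tens mu (bf i) (bf i) (bf j) (bf j)) !orth// eq_sym.
  by case: eqP; rewrite ?mul1r ?mul0r.
Qed.

Lemma mass_ge0 tau N : 0 <= mass tau N.
Proof. by apply: sumr_ge0 => i _; exact: sqr_ge0. Qed.

Lemma mass_le tau N : mass tau N <= \sum_(0 <= i < N) lam i ^+ 2.
Proof.
rewrite [leRHS](bigID (fun i => tau < `|lam i|))/= lerDl.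
by apply: sumr_ge0 => i _; exact: sqr_ge0.
Qed.

Lemma size_mass_le tau N : 0 <= tau ->
  (size [seq i <- index_iota 0 N | tau < `|lam i|])%:R * tau ^+ 2 <= mass tau N.
Proof.
move=> t0; rewrite /mass -big_filter mulr_natl.
set r := [seq _ <- _ | _].
have hr i : i \in r -> tau ^+ 2 <= lam i ^+ 2.
  rewrite mem_filter => /andP[li _].
  by rewrite -(real_normK (num_real (lam i))) ler_sqr ?nnegrE// ltW.
elim: r hr => [|i r IH] hr.
  by rewrite big_nil mulr0n.
rewrite big_cons /= mulrS; apply: lerD; first by apply: hr; rewrite inE eqxx.
by apply: IH => j jr; apply: hr; rewrite inE jr orbT.
Qed.

Hypothesis conv : forall e, 0 < e -> exists N, forall n, (N <= n)%N ->
  nrm mu2 (fun z => A z - \sum_(0 <= i < n) T i z) <= e.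

Lemma trunc_stable tau N n : (forall i, (N <= i)%N -> `|lam i| <= tau) ->
  (N <= n)%N -> trunc tau n = trunc tau N.
Proof.
move=> hN Nn; apply/funext => z; rewrite /trunc (big_cat_nat _ Nn)//=.
rewrite [X in _ + X]big_nat_cond [X in _ + X]big1 ?addr0// => i.
by move=> /andP[/andP[Ni _]]; rewrite ltNge hN.
Qed.

(** A long partial sum is close to [A] in [L_2], hence as an operator. The terms of it that [trunc]
    omits have eigenvalues at most [tau], and Bessel bounds their joint action. *)
Lemma residual_le tau N g : 0 <= tau ->
  (forall i, (N <= i)%N -> `|lam i| <= tau) -> bm g ->
  nrm mu (kact mu (fun z => A z - trunc tau N z) g) <= tau * nrm mu g.
Proof.
move=> t0 hN bg; apply/ler_addgt0Pl => e e0.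
have g1 : 0 < nrm mu g + 1 by rewrite ltr_wpDl// nrm_ge0.
have [K hK] := conv (divr_gt0 e0 g1).
pose n := maxn N K.
have bSn : bm (fun z => \sum_(0 <= i < n) T i z) by apply: bm_sum.
pose D z := A z - \sum_(0 <= i < n) T i z.
have bD : bm D by exact: bmB.
(* Zero eigenvalues contribute nothing and are dropped, as their functions need not be
   orthonormal. *)
pose r := [seq i <- index_iota 0 n | (lam i != 0) && (`|lam i| <= tau)].
pose S z := \sum_(i <- r) T i z.
have bS : bm S by apply: bm_sum.
have -> : (fun z => A z - trunc tau N z) = (fun z => D z + S z).
  rewrite -(trunc_stable hN (leq_maxl N K)) -/n; apply/funext => z.
  rewrite /D /S /trunc /r big_filter.
  rewrite [X in _ = _ - X + _](bigID (fun i => tau < `|lam i|))/= opprD addrA.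
  rewrite [X in _ = _ + X](_ : _ = \sum_(0 <= i < n | ~~ (tau < `|lam i|)) T i z).
    by rewrite subrK.
  rewrite [RHS](bigID (fun i => lam i == 0))/= [X in _ = X + _]big1 ?add0r.
    by apply: eq_bigl => i; rewrite -leNgt andbC.
  by move=> i /andP[_ /eqP li]; rewrite /T /rank_one li rmorph0 mul0r.
have -> : kact mu (fun z => D z + S z) g = (fun x => kact mu D g x + kact mu S g x).
  apply/funext => x; rewrite /kact -cintD; last 2 first.
  - by apply: bmM => //; exact: bm_pair.
  - by apply: bmM => //; exact: bm_pair.
  by apply: eq_cint => w; rewrite mulrDl.
apply: le_trans (nrmD mu (bm_kact mu bD bg) (bm_kact mu bS bg)) _.
apply: lerD.
  apply: le_trans (nrm_kact_le mu bD bg) _.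
  apply: le_trans (_ : _ <= (e / (nrm mu g + 1)) * (nrm mu g + 1)) _.
    by rewrite ler_pM ?nrm_ge0 ?hK ?leq_maxr// lerDl.
  by rewrite divfK// gt_eqF.
have -> : kact mu S g = (fun x => \sum_(i <- r) ((lam i)%:C * inner mu g (f i)) * f i x).
  rewrite /S (kact_sum r xpredT bT bg); apply/funext => x; apply: eq_bigr => i _.
  by rewrite (kact_rank_one mu (lam i) (bf i) bg).
have lr i : i \in r -> lam i != 0 /\ `|lam i| <= tau.
  by rewrite mem_filter => /andP[/andP[]].
have ur : uniq r by rewrite filter_uniq// iota_uniq.
have orr i j : i \in r -> j \in r -> inner mu (f i) (f j) = (i == j)%:R.
  by move=> /lr[li _] /lr[lj _]; exact: orth.
rewrite -ler_sqr ?nnegrE ?nrm_ge0 ?mulr_ge0 ?nrm_ge0// exprMn !sqr_nrm.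
rewrite (nsq_orthonormal ur bf orr).
apply: le_trans (_ : _ <= tau ^+ 2 * \sum_(i <- r) normc (inner mu g (f i)) ^+ 2) _.
  rewrite mulr_sumr big_seq [leRHS]big_seq; apply: ler_sum => i /lr[_ li].
  rewrite ComplexField.Normc.normcM normc_real exprMn.
  by rewrite ler_wpM2r ?sqr_ge0// ler_sqr ?nnegrE.
by rewrite ler_wpM2l ?sqr_ge0// bessel.
Qed.

End Truncation.

Section SpectralTruncation.
Context {d : measure_display} {V : measurableType d} {R : realType}.
Variable mu : probability V R.
Local Notation mu2 := (mu \x mu)%E.

Lemma truncation_of_eigensystem (M A : V * V -> R[i]) lam f x N :
  0 < x -> kernel_operator mu M -> bm A -> {ae mu2, forall z, M z = A z} ->
  eigensystem mu A lam f -> (forall i, (N <= i)%N -> `|lam i| <= x) ->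
  is_spectral_truncation mu M x (trunc lam f x N).
Proof.
move=> x0 kM bA MA [ef orth sums conv] lamN.
have bf i : bm (f i) by have [] := ef i.
have bT i : bm (rank_one (lam i) (f i)) by exact: bm_rank_one.
(* The index set keeps the nonzero eigenvalues, for which orthonormality is known; the other terms
   vanish. *)
exists (fun i => lam i != 0), lam, f; split; first split.
- by move=> i _; exact: bm_in_L2.
- exact: orth.
- split=> //.
  have -> : (fun n => norm2 mu (fun z => M z -
      \sum_(0 <= i < n | lam i != 0) (lam i)%:C * (f i z.1 * (f i z.2)^*%C))) =
    (fun n => norm2 mu (fun z => A z - \sum_(0 <= i < n) rank_one (lam i) (f i) z)).
    apply/funext => n; apply: cnorm2_ae.
    + apply: cmeasurableD; first by have [] := kM.
      by apply: bm_cmeasurable; apply: bmN; apply: bm_sum => i _; exact: bT.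
    + by apply: bm_cmeasurable; apply: bmB => //; apply: bm_sum => i _; exact: bT.
    move: MA; apply: filterS => z ->; congr (_ - _).
    rewrite [RHS](bigID (fun i => lam i == 0))/= [X in _ = X + _]big1 ?add0r//.
    by move=> i /eqP li; rewrite /rank_one li rmorph0 mul0r.
  apply: norm2_cvg0 => // n; apply: bmB => //.
  by apply: bm_sum => i _; exact: bT.
- split; first by apply: kernel_of_bm; exact: bm_trunc.
  have E n : (fun z => trunc lam f x N z - \sum_(0 <= i < n | (lam i != 0) && (x < `|lam i|))
      (lam i)%:C * (f i z.1 * (f i z.2)^*%C)) =
      (fun z => trunc lam f x N z - trunc lam f x n z).
    apply/funext => z; congr (_ - _); apply: eq_bigl => i.
    by apply: andb_idl => li; rewrite -normr_gt0 (lt_trans x0).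
  under eq_fun do rewrite E.
  apply: norm2_cvg0 => [n|e e0]; first by apply: bmB; exact: bm_trunc.
  (* From [N] on the partial sums equal [trunc], so the error is exactly 0. *)
  exists N => n Nn; rewrite (trunc_stable f lamN Nn).
  apply: nrm_le; rewrite ?(ltW e0)//; first by apply: bmB; exact: bm_trunc.
  by move=> z; rewrite subrr ComplexField.Normc.normc0 ltW.
Qed.

End SpectralTruncation.

(** * Conditional expectation on finitely many cells *)

Section Averaging.
Context {d : measure_display} {V : measurableType d} {R : realType}.
Variable mu : probability V R.
Local Notation mu2 := (mu \x mu)%E.
Variables (L : finType) (c : V -> L).
Hypothesis mc : forall l, measurable (c @^-1` [set l]).

Definition cell l : V -> R[i] := fun x => (\1_(c @^-1` [set l]) x)%:C.
Definition cell_mass l : R := nsq mu (cell l).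
Local Notation p := cell_mass.

(* The kernel of the conditional expectation on the cells of [c]; null cells
   contribute nothing because [0^-1 = 0]. *)
Definition avg : V * V -> R[i] := fun z => \sum_l rank_one (p l)^-1 (cell l) z.

Lemma cellE l x : cell l x = (c x == l)%:R.
Proof.
rewrite /cell indicE; case: eqP => [<-|cl]; first by rewrite mem_set.
by rewrite memNset.
Qed.

Lemma bm_cell l : bm (cell l). Proof. exact: bm_indic. Qed.
Let bcell := bm_cell.
Let brk l : bm (rank_one (p l)^-1 (cell l)). Proof. exact: bm_rank_one. Qed.

Lemma bm_avg : bm avg. Proof. by apply: bm_sum => l _; exact: brk. Qed.
Let bQ := bm_avg.

Lemma kadj_avg : kadj avg = avg.
Proof. by apply: kadj_sum => l; exact: kadj_rank_one. Qed.

Let inner_cell l k : inner mu (cell l) (cell k) = (l == k)%:R * (p l)%:C.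
Proof.
case: eqP => [->|lk]; first by rewrite inner_nsq mul1r.
rewrite mul0r /inner -[RHS](cint_cst mu 0); apply: eq_cint => x; rewrite !cellE.
case: eqP => [->|_]; last by rewrite mul0r.
by case: eqP => [kl|_]; rewrite ?conjc0 ?mulr0//; case: lk.
Qed.

Lemma kact_avgE g x : bm g ->
  kact mu avg g x = ((p (c x))^-1)%:C * inner mu g (cell (c x)).
Proof.
move=> bg; rewrite /avg (kact_sum mu _ _ brk bg).
rewrite (bigD1 (c x))//= big1 ?addr0 => [|l lc].
  by rewrite (kact_rank_one mu _ (bcell _) bg) cellE eqxx mulr1.
by rewrite (kact_rank_one mu _ (bcell _) bg) cellE eq_sym (negbTE lc) mulr0.
Qed.

(** Stated so as to hold on null cells too, where both sides are 0. *)
Let invpp l : (p l)^-1 * (p l)^-1 * p l = (p l)^-1.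
Proof.
have [->|p0] := eqVneq (p l) 0; first by rewrite invr0 mulr0.
by rewrite mulrAC mulfK.
Qed.

Lemma kact_avg_cell l : kact mu avg (cell l) = (fun x => ((p l)^-1 * p l)%:C * cell l x).
Proof.
apply/funext => x; rewrite kact_avgE// inner_cell cellE eq_sym.
case: eqP => [->|_]; last by rewrite mul0r !mulr0.
by rewrite mul1r mulr1 rmorphM.
Qed.

Lemma avg_idem : kmul mu avg avg = avg.
Proof.
rewrite {2}/avg (kmul_sumr mu _ _ brk bQ); apply/funext => z.
apply: eq_bigr => l _; rewrite /rank_one.
rewrite (kmulZr mu _ (bm_ktens (bcell l) (bcell l)) bQ).
rewrite (kmul_tensl mu bQ (bcell l) (bcell l)) kact_avg_cell /ktens !mulrA.
by rewrite -rmorphM mulrA invpp.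
Qed.

(** [avg] is an orthogonal projection, so [||Q X||^2 = <X, Q X>]; Cauchy-Schwarz and division by
    [||Q X||] conclude. *)
Lemma nrm_avg_kmul X : bm X -> nrm mu2 (kmul mu avg X) <= nrm mu2 X.
Proof.
move=> bX; have bQX := bm_kmul mu bQ bX.
have [->|n0] := eqVneq (nrm mu2 (kmul mu avg X)) 0; first exact: nrm_ge0.
rewrite -(ler_pM2r (_ : 0 < nrm mu2 (kmul mu avg X))); last first.
  by rewrite lt_neqAle eq_sym n0 nrm_ge0.
rewrite -expr2 sqr_nrm.
apply: le_trans (cauchy_schwarz mu2 bX bQX).
have -> : inner mu2 X (kmul mu avg X) = (nsq mu2 (kmul mu avg X))%:C.
  rewrite -inner_nsq (inner_kmull mu bQ bX bQX) kadj_avg.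
  by rewrite -(kmulA mu bQ bQ bX) avg_idem.
by rewrite normc_real ger0_norm ?nsq_ge0.
Qed.

Lemma nrm_kmul_avg X : bm X -> nrm mu2 (kmul mu X avg) <= nrm mu2 X.
Proof.
move=> bX; rewrite -(nrm_kadj mu (bm_kmul mu bX bQ)) (kadj_mul mu bX bQ) kadj_avg.
by rewrite -(nrm_kadj mu bX); apply: nrm_avg_kmul; exact: bm_kadj.
Qed.

Lemma nrm_avg_kact g : bm g -> nrm mu (kact mu avg g) <= nrm mu g.
Proof.
move=> bg; have bQg := bm_kact mu bQ bg.
have [->|n0] := eqVneq (nrm mu (kact mu avg g)) 0; first exact: nrm_ge0.
rewrite -(ler_pM2r (_ : 0 < nrm mu (kact mu avg g))); last first.
  by rewrite lt_neqAle eq_sym n0 nrm_ge0.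
rewrite -expr2 sqr_nrm.
apply: le_trans (cauchy_schwarz mu bg bQg).
have -> : inner mu g (kact mu avg g) = (nsq mu (kact mu avg g))%:C.
  rewrite -inner_nsq (inner_kact mu bQ bg bQg) kadj_avg.
  by rewrite -(kact_mul mu bQ bQ bg) avg_idem.
by rewrite normc_real ger0_norm ?nsq_ge0.
Qed.

(** The squared Hilbert-Schmidt norm of a projection is its rank: a cell of positive measure
    contributes 1, a null cell 0. *)
Lemma nsq_avg_le : nsq mu2 avg <= #|L|%:R.
Proof.
have -> : nsq mu2 avg = \sum_l (p l)^-1 * p l * ((p l)^-1 * p l).
  apply: (@complexI R); rewrite -inner_nsq (innerJ mu2 bQ bQ) {1}/avg.
  rewrite (inner_suml mu2 _ (fun l _ => brk l) bQ) conjc_sum rmorph_sum.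
  apply: eq_bigr => l _; rewrite /rank_one (innerZl mu2 _ (bm_ktens (bcell l) (bcell l)) bQ).
  rewrite conjcM conjc_real -(innerJ mu2 (bm_ktens (bcell l) (bcell l)) bQ).
  rewrite (inner_tens mu bQ (bcell l) (bcell l)) kact_avg_cell.
  by rewrite (innerZl mu _ (bcell l) (bcell l)) inner_nsq -!rmorphM mulrCA mulrA.
rewrite -sum1_card natr_sum; apply: ler_sum => l _.
have [->|p0] := eqVneq (p l) 0; first by rewrite !mulr0.
by rewrite mulVf// mulr1.
Qed.

Let cell_bound g l (M : R) : 0 <= M -> bm g -> (forall y, c y = l -> normc (g y) <= M) ->
  normc (inner mu g (cell l)) <= M * p l.
Proof.
move=> M0 bg gM.
have bgc : bm (fun x => g x * cell l x) by exact: bmM.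
have -> : inner mu g (cell l) = inner mu (fun x => g x * cell l x) (cell l).
  apply: eq_cint => x; rewrite !cellE; case: eqP => _; last by rewrite conjc0 !mulr0.
  by rewrite mulr1.
apply: le_trans (cauchy_schwarz mu bgc (bcell l)) _.
rewrite /p -sqr_nrm expr2 mulrA ler_wpM2r ?nrm_ge0//.
have -> : M * nrm mu (cell l) = nrm mu (fun x => M%:C * cell l x).
  by rewrite nrmZ// normc_real ger0_norm.
rewrite -ler_sqr ?nnegrE ?nrm_ge0// !sqr_nrm; apply: le_nsq => //.
  by apply: bmM => //; exact: bm_cst.
move=> x; rewrite !ComplexField.Normc.normcM cellE; case: eqP => [cx|_].
  by rewrite ler_wpM2r ?normc_ge0// normc_real ger0_norm// gM.
by rewrite ComplexField.Normc.normc0 !mulr0.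
Qed.

Let avg_cell_le g x (M : R) : 0 <= M -> bm g ->
  (forall y, c y = c x -> normc (g y) <= M) -> normc (kact mu avg g x) <= M.
Proof.
move=> M0 bg gM; rewrite kact_avgE// ComplexField.Normc.normcM normc_real.
rewrite ger0_norm ?invr_ge0 ?nsq_ge0//.
have [->|p0] := eqVneq (p (c x)) 0; first by rewrite invr0 mul0r.
rewrite ler_pdivrMl ?lt_neqAle 1?eq_sym ?p0 ?nsq_ge0// mulrC.
exact: cell_bound.
Qed.

Lemma avg_sup g (M : R) : 0 <= M -> bm g -> (forall y, normc (g y) <= M) ->
  forall x, normc (kact mu avg g x) <= M.
Proof. by move=> M0 bg gM x; apply: avg_cell_le. Qed.

Lemma avg_approx g x (h : R) : 0 <= h -> bm g -> p (c x) != 0 ->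
  (forall y, c y = c x -> normc (g x - g y) <= h) ->
  normc (g x - kact mu avg g x) <= h.
Proof.
move=> h0 bg p0 gh.
have bgx : bm (fun _ : V => g x) by exact: bm_cst.
have -> : g x - kact mu avg g x = kact mu avg (fun y => g x - g y) x.
  have bD : bm (fun y => g x - g y) by exact: bmB.
  rewrite !kact_avgE// (innerBl mu bgx bg (bcell _)) mulrBr; congr (_ - _).
  have -> : inner mu (fun=> g x) (cell (c x)) = inner mu (fun y => g x * cell (c x) y) (cell (c x)).
    apply: eq_cint => y; rewrite !cellE; case: eqP => _; last by rewrite conjc0 !mulr0.
    by rewrite mulr1.
  rewrite (innerZl mu _ (bcell _) (bcell _)) inner_nsq mulrCA -rmorphM mulVf//.
  by rewrite rmorph1 mulr1.
by apply: avg_cell_le => //; exact: bmB.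
Qed.

(** Averaging acts on columns, then through the adjoint on rows. This is the source of the bound on
    [S + E]. *)
Lemma kmul_avg2_sup B (M : R) : 0 <= M -> bm B -> (forall z, normc (B z) <= M) ->
  forall z, normc (kmul mu avg (kmul mu B avg) z) <= M.
Proof.
move=> M0 bB hB.
have half X : bm X -> (forall z, normc (X z) <= M) -> forall z, normc (kmul mu avg X z) <= M.
  move=> bX hX [x y]; apply: (avg_sup M0 (g := fun w => X (w, y))) => //.
  exact: bm_pair.
apply: (half); first exact: bm_kmul.
have bB' := bm_kadj bB.
move=> z; rewrite -(kadjK (kmul mu B avg)) (kadj_mul mu bB bQ) kadj_avg /kadj normc_conj.
by apply: (half) => // z'; rewrite normc_conj.
Qed.

(** Marks the points where [avg_approx] says nothing; its norm is 0. *)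
Definition null_cells x : R[i] := \sum_(l | p l == 0) cell l x.

Lemma bm_null_cells : bm null_cells.
Proof. by apply: bm_sum => l _; exact: bcell. Qed.

Lemma null_cellsE x : null_cells x = (p (c x) == 0)%:R.
Proof.
rewrite /null_cells; case: eqP => p0.
  rewrite (bigD1 (c x))//=; last by rewrite p0.
  rewrite big1 ?addr0 ?cellE ?eqxx// => l /andP[_ lc].
  by rewrite cellE eq_sym (negbTE lc).
rewrite big1// => l /eqP pl; rewrite cellE; case: eqP => // cl.
by case: p0; rewrite cl.
Qed.

Lemma nrm_null_cells : nrm mu null_cells = 0.
Proof.
apply/eqP; rewrite eq_le nrm_ge0 andbT.
apply: le_trans (nrm_sum mu _ (fun l _ => bcell l)) _.
rewrite big1// => l /eqP pl; apply/eqP.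
by rewrite -sqrf_eq0 sqr_nrm; apply/eqP.
Qed.

End Averaging.

(** * Comparison of a kernel with its average *)

Section Step.
Context {d : measure_display} {V : measurableType d} {R : realType}.
Variable mu : probability V R.
Local Notation mu2 := (mu \x mu)%E.

(** The operator bound is applied to each column of [X] and integrated. *)
Lemma nrm_kmul_le_op B X (t : R) : 0 <= t -> bm B -> bm X ->
  (forall g, bm g -> nrm mu (kact mu B g) <= t * nrm mu g) ->
  nrm mu2 (kmul mu B X) <= t * nrm mu2 X.
Proof.
move=> t0 bB bX hB.
rewrite -ler_sqr ?nnegrE ?nrm_ge0 ?mulr_ge0 ?nrm_ge0// exprMn !sqr_nrm.
rewrite (nsq2E mu (bm_kmul mu bB bX)) [in leRHS](nsq2E mu bX).
have [C hC mC] := measurable_nsq1 mu bX.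
have [C' hC' mC'] := measurable_nsq1 mu (bm_kmul mu bB bX).
have iC := bounded_integrable mu mC hC.
rewrite -RintegralZl//; apply: le_Rintegral => //.
- exact: bounded_integrable mC' hC'.
- by have := @integrableZl _ _ _ mu setT measurableT (t ^+ 2) _ iC.
- move=> y _; rewrite kmul_col -!sqr_nrm -exprMn ler_sqr ?nnegrE ?nrm_ge0//.
    by apply: hB; exact: bm_pair.
  by rewrite mulr_ge0// nrm_ge0.
Qed.

Variables (A : V * V -> R[i]) (lam : nat -> R) (f : nat -> V -> R[i]).
Hypothesis bA : bm A.
Hypothesis sA : kadj A = A.
Hypothesis A1 : forall z, normc (A z) <= 1.
Hypothesis bf : forall i, bm (f i).
Hypothesis Af : forall i, kact mu A (f i) = (fun x => (lam i)%:C * f i x).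
Hypothesis orth :
  forall i j, lam i != 0 -> lam j != 0 -> inner mu (f i) (f j) = (i == j)%:R.

(** [lam i * f i x] is the value of [A (f i)] at [x], an inner product of the unit vector [f i] with
    a row bounded by 1. *)
Lemma eigfun_sup i x : lam i != 0 -> normc ((lam i)%:C * f i x) <= 1.
Proof.
move=> li; have := congr1 (fun h => h x) (Af i); rewrite kact_inner => <-.
have bAx : bm (fun w => (A (x, w))^*%C) by apply: bmJ; exact: bm_pair.
apply: le_trans (cauchy_schwarz mu (bf i) bAx) _.
have -> : nrm mu (f i) = 1.
  apply/eqP; rewrite -(@eqrXn2 _ 2) ?nrm_ge0// sqr_nrm expr1n; apply/eqP.
  by apply: (@complexI R); rewrite -inner_nsq orth// eqxx.
by rewrite mul1r; apply: nrm_le => // w; rewrite normc_conj.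
Qed.

Section Cells.
Variables (L : finType) (c : V -> L).
Hypothesis mc : forall l, measurable (c @^-1` [set l]).
Local Notation Q := (avg mu c).
Let bQ : bm Q := bm_avg mu mc.

Definition sandwich X : V * V -> R[i] := kmul mu Q (kmul mu X Q).

Lemma bm_sandwich X : bm X -> bm (sandwich X).
Proof. by move=> bX; do 2 apply: bm_kmul => //. Qed.

Lemma sandwichB X Y : bm X -> bm Y ->
  sandwich (fun z => X z - Y z) = (fun z => sandwich X z - sandwich Y z).
Proof.
move=> bX bY; rewrite /sandwich (kmulBl mu bX bY bQ).
by rewrite (kmulBr mu (bm_kmul mu bX bQ) (bm_kmul mu bY bQ) bQ).
Qed.

Lemma kadj_sandwich X : bm X -> kadj X = X -> kadj (sandwich X) = sandwich X.
Proof.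
move=> bX sX; rewrite /sandwich (kadj_mul mu bQ (bm_kmul mu bX bQ)).
by rewrite (kadj_mul mu bX bQ) sX (kadj_avg mu c) (kmulA mu bQ bX bQ).
Qed.

Lemma nrm_sandwich X : bm X -> nrm mu2 (sandwich X) <= nrm mu2 X.
Proof.
move=> bX; apply: le_trans (nrm_avg_kmul mu mc (bm_kmul mu bX bQ)) _.
exact: nrm_kmul_avg.
Qed.

Lemma nrm_kact_sandwich X (t : R) g : 0 <= t -> bm X -> bm g ->
  (forall g, bm g -> nrm mu (kact mu X g) <= t * nrm mu g) ->
  nrm mu (kact mu (sandwich X) g) <= t * nrm mu g.
Proof.
move=> t0 bX bg hX; have bQg := bm_kact mu bQ bg.
rewrite /sandwich (kact_mul mu bQ (bm_kmul mu bX bQ) bg) (kact_mul mu bX bQ bg).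
apply: le_trans (nrm_avg_kact mu mc (bm_kact mu bX bQg)) _.
apply: le_trans (hX _ bQg) _; rewrite ler_wpM2l//.
exact: nrm_avg_kact.
Qed.

Variables (tau h : R) (N m : nat).
Hypothesis tau0 : 0 < tau.
Hypothesis h0 : 0 <= h.
Hypothesis hf : forall i, (i < N)%N -> tau < `|lam i| ->
  forall x y, c x = c y -> normc (f i x - f i y) <= h.
Hypothesis sm : (size [seq i <- index_iota 0 N | (tau < `|lam i|)%R] <= m)%N.

Local Notation M := (trunc lam f tau N).
Let bM : bm M := bm_trunc lam bf tau N.

(** Each of at most [m] terms is a product of [f_i - Q f_i], at most [h] off the null cells, and the
    conjugate of [lam_i f_i], at most 1 everywhere. *)
Let nrm_trunc_half : nrm mu2 (fun z => M z - kmul mu Q M z) <= h * m%:R.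
Proof.
pose D z := M z - kmul mu Q M z.
have bD : bm D by apply: bmB => //; exact: bm_kmul.
have [B B0 hB] := bm_bound bD.
pose u : V * V -> R[i] := ktens (null_cells mu c) (fun=> 1).
have bu : bm u by apply: bm_ktens; [exact: bm_null_cells|exact: bm_cst].
have hm0 : 0 <= h * m%:R by rewrite mulr_ge0.
have nu : nrm mu2 u = 0.
  apply/eqP; rewrite -sqrf_eq0 sqr_nrm.
  rewrite (nsq_tens mu (bm_null_cells mu mc) (bm_cst 1)) -sqr_nrm.
  by rewrite (nrm_null_cells mu mc) expr0n mul0r.
(* On null cells only the crude bound [B] is available; it costs nothing, as [u] has norm 0. *)
pose W z := (h * m%:R)%:C + B%:C * u z.
have bW : bm W.
  by apply: bmD; [exact: bm_cst|apply: bmM => //; exact: bm_cst].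
have -> : h * m%:R = h * m%:R + B * nrm mu2 u by rewrite nu mulr0 addr0.
have DE z : D z = \sum_(0 <= i < N | tau < `|lam i|)
    (f i z.1 - kact mu Q (f i) z.1) * ((lam i)%:C * f i z.2)^*%C.
  rewrite /D /trunc (kmul_sumr mu _ _ (fun i => bm_rank_one (lam i) (bf i)) bQ).
  rewrite -sumrB; apply: eq_bigr => i _; rewrite /rank_one.
  rewrite (kmulZr mu _ (bm_ktens (bf i) (bf i)) bQ) (kmul_tensl mu bQ (bf i) (bf i)).
  by rewrite /ktens conjcM conjc_real; ring.
have DW z : normc (D z) <= normc (W z).
  have uE : u z = (cell_mass mu c (c z.1) == 0)%:R.
    by rewrite /u/ktens null_cellsE conjc1 mulr1.
  rewrite /W uE; case: eqP => [_|/eqP p0].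
    rewrite mulr1 -rmorphD normc_real ger0_norm ?addr_ge0 ?(ltW B0)//.
    by apply: le_trans (hB z) _; rewrite lerDr.
  rewrite mulr0 addr0 normc_real ger0_norm// DE.
  apply: le_trans (normc_sum _ _ _) _.
  apply: le_trans (_ : _ <= \sum_(0 <= i < N | tau < `|lam i|) h) _.
    rewrite big_nat_cond [leRHS]big_nat_cond.
    apply: ler_sum => i /andP[/andP[_ iN] li].
    have li0 : lam i != 0 by rewrite -normr_gt0 (lt_trans tau0).
    rewrite ComplexField.Normc.normcM normc_conj -[leRHS]mulr1.
    apply: ler_pM; rewrite ?normc_ge0 ?eigfun_sup//.
    by apply: avg_approx => // y cy; apply: hf.
  rewrite -big_filter; set s := [seq _ <- _ | _].
  have -> : \sum_(i <- s) h = h * (size s)%:R.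
    elim: s => [|i s IH]; first by rewrite big_nil mulr0.
    by rewrite big_cons IH /= -[in RHS]addn1 natrD mulrDr mulr1 addrC.
  by rewrite ler_wpM2l// ler_nat.
have : nrm mu2 D <= nrm mu2 W.
  by rewrite -ler_sqr ?nnegrE ?nrm_ge0// !sqr_nrm; apply: le_nsq.
move/le_trans; apply.
have bBu : bm (fun z => B%:C * u z) by apply: bmM => //; exact: bm_cst.
apply: le_trans (nrmD mu2 (bm_cst _) bBu) _.
apply: lerD.
  by apply: nrm_le => //; [exact: bm_cst|move=> z; rewrite normc_real ger0_norm].
by rewrite (nrmZ mu2 _ bu) normc_real gtr0_norm.
Qed.

(** [M - Q M Q = (M - Q M) + Q (M - M Q)], and [M - M Q] is the adjoint of [M - Q M]. *)
Lemma nrm_trunc_sandwich : nrm mu2 (fun z => M z - sandwich M z) <= 2 * (h * m%:R).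
Proof.
have sM : kadj M = M := kadj_trunc lam f tau N.
have bQM := bm_kmul mu bQ bM; have bMQ := bm_kmul mu bM bQ.
have bH : bm (fun z => M z - kmul mu M Q z) by exact: bmB.
have bD : bm (fun z => M z - kmul mu Q M z) by exact: bmB.
have -> : (fun z => M z - sandwich M z) =
    (fun z => (M z - kmul mu Q M z) + kmul mu Q (fun z => M z - kmul mu M Q z) z).
  by apply/funext => z; rewrite (kmulBr mu bM bMQ bQ) /sandwich addrA subrK.
apply: le_trans (nrmD mu2 bD (bm_kmul mu bQ bH)) _.
rewrite mulr_natl mulr2n; apply: lerD => //.
apply: le_trans (nrm_avg_kmul mu mc bH) _.
rewrite -(nrm_kadj mu bH).
have -> : kadj (fun z => M z - kmul mu M Q z) = (fun z => M z - kmul mu Q M z).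
  have e : kadj (kmul mu M Q) = kmul mu Q M.
    by rewrite (kadj_mul mu bM bQ) sM (kadj_avg mu c).
  apply/funext => z; rewrite /kadj conjcB; congr (_ - _).
    exact: (congr1 (fun X => X z) sM).
  exact: (congr1 (fun X => X z) e).
exact: nrm_trunc_half.
Qed.

End Cells.

End Step.

(** * The regularity lemma *)

#[local] Opaque kact kmul sandwich trunc avg.

(* The scales are [y <= tau <= x]: the eigenfunctions above [tau] determine the
   partition, [tau] bounds the cut norm of the remainder, and [y] is so small
   that averaging over the partition makes the part of [A] below [y] small
   in [L_2]. *)
Lemma regularity_step {R : realType} (eps b x : R) :
  0 < eps -> 0 < b -> 0 < x ->
  exists y, [/\ 0 < y, y <= x &
    forall d (V : measurableType d) (mu : probability V R) A lam f N,
      bm A -> kadj A = A -> (forall z, normc (A z) <= 1) ->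
      eigensystem mu A lam f -> (forall i, (N <= i)%N -> `|lam i| <= y) ->
      mass lam y N - mass lam x N <= (eps / 4) ^+ 2 ->
      exists B : V * V -> R[i],
        [/\ bm B, kadj B = B, forall z, normc (B z) <= 1,
          nrm (mu \x mu)%E (fun z => B z - trunc lam f x N z) <= eps &
          forall g, bm g -> (forall v, normc (g v) <= 1) ->
            nrm mu (kact mu (fun z => A z - B z) g) <= b]].
Proof.
move=> eps0 b0 x0.
(* Two of the three cut-norm errors below are at most [tau]; each is allowed [b / 4]. *)
pose tau := Num.min x (b / 4).
have tau0 : 0 < tau by rewrite lt_min x0 divr_gt0.
(* At most [tau^-2] eigenvalues exceed [tau] in modulus, as their squares sum to at most 1. *)
pose m := (Num.truncn (tau ^- 2)).+1.
have m0 : 0 < m%:R :> R by rewrite ltr0n.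
(* Averaging the part above [tau] then costs at most [eps / 4] in [L_2] and [b / 2] in cut norm. *)
pose h := Num.min (eps / 4) (b / 2) / (2 * m%:R).
have h0 : 0 < h by rewrite divr_gt0 ?mulr_gt0// lt_min !divr_gt0.
have hm : 2 * (h * m%:R) = Num.min (eps / 4) (b / 2).
  by rewrite /h; field; rewrite gt_eqF.
have [L hL] := @quantize R m tau^-1 h h0.
have K0 : 0 < (#|L|%:R + 1 : R) by rewrite ltr_wpDl.
pose y := Num.min tau (eps / (4 * (#|L|%:R + 1))).
have y0 : 0 < y by rewrite lt_min tau0 divr_gt0// mulr_gt0.
have ytau : y <= tau by rewrite ge_min lexx.
have taux : tau <= x by rewrite ge_min lexx.
exists y; split => //; first exact: le_trans ytau taux.
move=> d V mu A lam f N bA sA A1 [ef orth sums conv] lamN massN.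
have bf i : bm (f i) by have [] := ef i.
have Af i : kact mu A (f i) = (fun x => (lam i)%:C * f i x) by have [] := ef i.
have lamNtau i : (N <= i)%N -> `|lam i| <= tau by move=> /lamN /le_trans; apply.
pose s := [seq i <- index_iota 0 N | tau < `|lam i|].
have ms : (size s <= m)%N.
  have nA : nsq (mu \x mu)%E A <= 1.
    by rewrite -sqr_nrm -[leRHS](expr1n _ 2) ler_sqr ?nnegrE ?nrm_ge0//; exact: nrm_le.
  have := le_trans (size_mass_le lam N (ltW tau0)) (le_trans (mass_le lam tau N) (le_trans (sums N) nA)).
  rewrite -ler_pdivlMr ?exprn_gt0// div1r -/s => hs.
  rewrite -(ler_nat R); apply: le_trans hs _; apply: ltW.
  exact: truncnS_gt.
(* The partition was prepared for exactly [m] functions; zero functions fill the list. *)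
pose g j : V -> R[i] := if (j < size s)%N then f (nth 0%N s j) else fun=> 0.
have sP i : i \in s -> tau < `|lam i| by rewrite mem_filter => /andP[].
have sl i : i \in s -> lam i != 0.
  by move=> /sP li; rewrite -normr_gt0 (lt_trans tau0).
have [| |c [mc hc]] := hL d V (fun j : 'I_m => g j).
- by move=> j; rewrite /g; case: ifP => _; [have [] := bf (nth 0%N s j)|have [] := @bm_cst _ V R 0].
- move=> j v; rewrite /g; case: ifP => [js|_]; last first.
    by rewrite ComplexField.Normc.normc0 invr_ge0 ltW.
  have is_ := mem_nth 0%N js; set i := nth _ _ _ in is_ *.
  have := eigfun_sup bA A1 bf Af orth v (sl _ is_).
  rewrite ComplexField.Normc.normcM normc_real => hi.
  rewrite -[leRHS]mul1r ler_pdivlMr// mulrC.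
  by apply: le_trans hi; rewrite ler_wpM2r ?normc_ge0// ltW// sP.
have hcf i : (i < N)%N -> tau < `|lam i| ->
    forall v w, c v = c w -> normc (f i v - f i w) <= h.
  move=> iN li v w /hc hvw.
  have is_ : i \in s by rewrite mem_filter li mem_index_iota.
  have js : (index i s < size s)%N by rewrite index_mem.
  have := hvw (Ordinal (leq_trans js ms)).
  by rewrite /= /g js nth_index.
pose Q := avg mu c; have bQ : bm Q by exact: bm_avg.
pose M1 := trunc lam f tau N; pose M2 := trunc lam f y N; pose S := trunc lam f x N.
have bM1 : bm M1 by exact: bm_trunc.
have bM2 : bm M2 by exact: bm_trunc.
have bS : bm S by exact: bm_trunc.
have bsA := bm_sandwich mu mc bA; have bsM1 := bm_sandwich mu mc bM1.
have bsM2 := bm_sandwich mu mc bM2.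
have res1 g' : bm g' -> nrm mu (kact mu (fun z => A z - M1 z) g') <= tau * nrm mu g'.
  by move=> bg'; apply: (residual_le bA bf orth conv) => //; exact: ltW.
have res2 g' : bm g' -> nrm mu (kact mu (fun z => A z - M2 z) g') <= y * nrm mu g'.
  by move=> bg'; apply: (residual_le bA bf orth conv) => //; exact: ltW.
have bR1 : bm (fun z => A z - M1 z) by exact: bmB.
have bR2 : bm (fun z => A z - M2 z) by exact: bmB.
have D1 : nrm (mu \x mu)%E (fun z => M1 z - sandwich mu c M1 z) <= 2 * (h * m%:R).
  exact: (nrm_trunc_sandwich bA A1 bf Af orth mc tau0 (ltW h0) hcf ms).
exists (sandwich mu c A); split => //.
- exact: kadj_sandwich.
- exact: (kmul_avg2_sup mu mc ler01 bA A1).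
(* Four errors of size [eps / 4]: averaging the part above [tau], the eigenvalues in [(tau, x]], the
   averaged part from [(y, tau]], and the averaged part below [y]. The mass hypothesis bounds the
   middle two. *)
- pose E1 z := sandwich mu c M1 z - M1 z.
  pose E2 z := M1 z - S z.
  pose E3 z := sandwich mu c M2 z - sandwich mu c M1 z.
  pose E4 z := sandwich mu c A z - sandwich mu c M2 z.
  have bE1 : bm E1 by exact: bmB.
  have bE2 : bm E2 by exact: bmB.
  have bE3 : bm E3 by exact: bmB.
  have bE4 : bm E4 by exact: bmB.
  have -> : (fun z => sandwich mu c A z - S z) = (fun z => E1 z + E2 z + E3 z + E4 z).
    have tele (a q u v w : R[i]) : a - q = (u - v) + (v - q) + (w - u) + (a - w).
      by ring.
    by apply/funext => z; exact: tele.
  have eps4 : 0 <= eps / 4 by rewrite divr_ge0// ltW.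
  have -> : eps = eps / 4 + eps / 4 + eps / 4 + eps / 4 by field.
  have bE12 := bmD bE1 bE2; have bE123 := bmD bE12 bE3.
  apply: le_trans (nrmD (mu \x mu)%E bE123 bE4) _; apply: lerD.
    apply: le_trans (nrmD (mu \x mu)%E bE12 bE3) _; apply: lerD.
      apply: le_trans (nrmD (mu \x mu)%E bE1 bE2) _; apply: lerD.
        rewrite -nrmN /E1; under eq_fun do rewrite opprB.
        by apply: le_trans D1 _; rewrite hm ge_min lexx.
      rewrite -ler_sqr ?nnegrE ?nrm_ge0// sqr_nrm.
      rewrite (nsq_truncB bf orth N (ltW tau0) taux); apply: le_trans massN.
      rewrite lerD2r -subr_ge0 -(nsq_truncB bf orth N (ltW y0) ytau).
      exact: nsq_ge0.
    rewrite /E3 -(sandwichB mu mc bM2 bM1).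
    apply: le_trans (nrm_sandwich mu mc (bmB bM2 bM1)) _.
    rewrite -ler_sqr ?nnegrE ?nrm_ge0// sqr_nrm.
    rewrite (nsq_truncB bf orth N (ltW y0) ytau); apply: le_trans massN.
    rewrite lerD2l lerN2 -subr_ge0 -(nsq_truncB bf orth N (ltW tau0) taux).
    exact: nsq_ge0.
  (* The part below [y] has operator norm at most [y], and [||Q||_2] is at most the square root of
     the number of cells, here replaced by that number plus 1. *)
  rewrite /E4 -(sandwichB mu mc bA bM2).
  apply: le_trans (nrm_avg_kmul mu mc (bm_kmul mu bR2 bQ)) _.
  apply: le_trans (nrm_kmul_le_op (ltW y0) bR2 bQ res2) _.
  apply: le_trans (_ : _ <= eps / (4 * (#|L|%:R + 1)) * (#|L|%:R + 1)) _; last first.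
    by rewrite le_eqVlt; apply/orP; left; apply/eqP; field; rewrite gt_eqF.
  apply: ler_pM; rewrite ?nrm_ge0 ?(ltW y0)//; first by rewrite ge_min lexx orbT.
  rewrite -ler_sqr ?nnegrE ?nrm_ge0 ?(ltW K0)// sqr_nrm.
  apply: le_trans (nsq_avg_le mu mc) _.
  have c0 : 0 <= #|L|%:R :> R by [].
  rewrite sqrrD expr1n mulr1 -addrA; apply: le_trans (_ : _ <= #|L|%:R *+ 2 + 1) _.
    by rewrite mulr2n -addrA lerDl addr_ge0.
  by rewrite lerDr sqr_ge0.
move=> g' bg' g1.
have ng' : nrm mu g' <= 1 by exact: nrm_le.
(* [A - Q A Q] splits into [M1 - Q M1 Q], the residual [A - M1], and minus the averaged residual. *)
pose G1 v := kact mu (fun z => M1 z - sandwich mu c M1 z) g' v.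
pose G2 v := kact mu (fun z => A z - M1 z) g' v.
pose G3 v := kact mu (fun z => sandwich mu c A z - sandwich mu c M1 z) g' v.
have bD1 : bm (fun z => M1 z - sandwich mu c M1 z) by exact: bmB.
have bG1 : bm G1 by exact: bm_kact.
have bG2 : bm G2 by exact: bm_kact.
have bG3 : bm G3 by apply: bm_kact => //; exact: bmB.
have E0 := kactBl mu bA bsA bg'.
have E1 : G1 = _ := kactBl mu bM1 bsM1 bg'.
have E2 : G2 = _ := kactBl mu bA bM1 bg'.
have E3 : G3 = _ := kactBl mu bsA bsM1 bg'.
have tele (a q u v : R[i]) : a - q = (u - v) + (a - u) - (q - v) by ring.
have -> : kact mu (fun z => A z - sandwich mu c A z) g' = (fun v => G1 v + G2 v - G3 v).
  rewrite E0 E1 E2 E3; apply/funext => v; exact: tele.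
have -> : b = b / 2 + b / 4 + b / 4 by field.
have taub : tau <= b / 4 by rewrite ge_min lexx orbT.
have taub' t : t <= tau * nrm mu g' -> t <= b / 4.
  move=> /le_trans; apply; apply: le_trans taub.
  by rewrite ler_piMr// ltW.
apply: le_trans (nrmB mu (bmD bG1 bG2) bG3) _; apply: lerD.
  apply: le_trans (nrmD mu bG1 bG2) _; apply: lerD; last exact/taub'/res1.
  apply: le_trans (nrm_kact_le mu bD1 bg') _.
  apply: le_trans (_ : _ <= 2 * (h * m%:R) * 1) _.
    by apply: ler_pM; rewrite ?nrm_ge0.
  by rewrite mulr1 hm ge_min lexx orbT.
apply: taub'; rewrite /G3 -(sandwichB mu mc bA bM1).
by apply: (nrm_kact_sandwich mc) => //; exact: ltW.
Qed.

Theorem bounded_regularity {R : realType} (F : R -> R) (eps : R) :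
  (forall x, 0 < x -> 0 < F x) -> 0 < eps ->
  exists delta, 0 < delta /\
    forall d (V : measurableType d) (mu : probability V R) A lam f,
      bm A -> kadj A = A -> (forall z, normc (A z) <= 1) ->
      eigensystem mu A lam f ->
      exists x N (B : V * V -> R[i]),
        [/\ delta <= x, forall i, (N <= i)%N -> `|lam i| <= x &
        [/\ bm B, kadj B = B, forall z, normc (B z) <= 1,
          nrm (mu \x mu)%E (fun z => B z - trunc lam f x N z) <= eps &
          forall g, bm g -> (forall v, normc (g v) <= 1) ->
            nrm mu (kact mu (fun z => A z - B z) g) <= F x]].
Proof.
move=> F0 eps0.
have /choice[next nextP] : forall x : R, exists y, 0 < x -> [/\ 0 < y, y <= x &
    forall d (V : measurableType d) (mu : probability V R) A lam f N,
      bm A -> kadj A = A -> (forall z, normc (A z) <= 1) ->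
      eigensystem mu A lam f -> (forall i, (N <= i)%N -> `|lam i| <= y) ->
      mass lam y N - mass lam x N <= (eps / 4) ^+ 2 ->
      exists B : V * V -> R[i],
        [/\ bm B, kadj B = B, forall z, normc (B z) <= 1,
          nrm (mu \x mu)%E (fun z => B z - trunc lam f x N z) <= eps &
          forall g, bm g -> (forall v, normc (g v) <= 1) ->
            nrm mu (kact mu (fun z => A z - B z) g) <= F x]].
  move=> x; have [x0|x0] := ltP 0 x; last by exists 0.
  by have [y hy] := regularity_step eps0 (F0 _ x0) x0; exists y.
pose x k := iter k next 1.
have x0 k : 0 < x k.
  by elim: k => [|k IH]; [exact: ltr01|have [] := nextP _ IH].
have xS k : x k.+1 <= x k by have [] := nextP _ (x0 k).
have e0 : 0 < (eps / 4) ^+ 2 by rewrite exprn_gt0// divr_gt0.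
(* Chosen so that [n (eps / 4)^2 > 1]: not every one of [n] steps can carry mass above
   [(eps / 4)^2]. *)
pose n := (Num.truncn ((eps / 4) ^- 2)).+1.
exists (x n); split => // d V mu A lam f bA sA A1 es.
have [ef orth sums conv] := es.
have nA : nsq (mu \x mu)%E A <= 1.
  by rewrite -sqr_nrm -[leRHS](expr1n _ 2) ler_sqr ?nnegrE ?nrm_ge0//; exact: nrm_le.
have xle i j : (i <= j)%N -> x j <= x i.
  elim: j => [|j IH]; first by rewrite leqn0 => /eqP ->.
  rewrite leq_eqVlt => /orP[/eqP -> //|ij]; apply: le_trans (xS j) _; exact: IH.
(* Taken for the smallest scale [x n], so that one [N] serves all scales. *)
have [N lamN] : exists N, forall i, (N <= i)%N -> `|lam i| <= x n.
  have cs : cvgn (series (fun i => lam i ^+ 2)).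
    apply: nondecreasing_is_cvgn.
      by apply/nondecreasing_seqP => k; rewrite /series/= big_nat_recr//= lerDl sqr_ge0.
    by exists (nsq (mu \x mu)%E A) => _ [k _ <-]; exact: sums.
  move/cvg_series_cvg_0/cvgrPdist_lt : cs => /(_ (x n ^+ 2) (exprn_gt0 2 (x0 n))) [N _ hN].
  exists N => k /hN; rewrite /= sub0r normrN ger0_norm ?sqr_ge0// => hk.
  by rewrite -ler_sqr ?nnegrE ?(ltW (x0 n))// real_normK ?num_real// ltW.
(* Pigeonhole: the masses of the successive ranges telescope to at most 1. *)
have [k kn hk] : exists2 k, (k < n)%N &
    mass lam (x k.+1) N - mass lam (x k) N <= (eps / 4) ^+ 2.
  apply: contrapT => hno.
  have big k : (k < n)%N -> (eps / 4) ^+ 2 <= mass lam (x k.+1) N - mass lam (x k) N.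
    by move=> kn; rewrite leNgt; apply/negP => hk; apply: hno; exists k => //; exact: ltW.
  have : \sum_(0 <= k < n) (eps / 4) ^+ 2 <=
      \sum_(0 <= k < n) (mass lam (x k.+1) N - mass lam (x k) N).
    rewrite big_nat_cond [leRHS]big_nat_cond.
    by apply: ler_sum => k /andP[/andP[_ kn] _]; exact: big.
  rewrite telescope_sumr// sumr_const_nat subn0 => h1.
  have h2 : mass lam (x n) N - mass lam (x 0%N) N <= 1.
    rewrite lerBlDr; apply: le_trans (_ : _ <= 1) _.
      exact: le_trans (mass_le lam (x n) N) (le_trans (sums N) nA).
    by rewrite lerDl mass_ge0.
  have : n%:R * (eps / 4) ^+ 2 <= 1 by rewrite mulr_natl; exact: le_trans h1 h2.
  by rewrite -ler_pdivlMr// div1r leNgt truncnS_gt.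
have [_ _ hstep] := nextP _ (x0 k).
have [|B hB] := hstep d V mu A lam f N bA sA A1 es _ hk.
  by move=> i /lamN /le_trans; apply; exact: (xle k.+1 n kn).
exists (x k), N, B; split=> //; first exact/xle/ltnW.
by move=> i /lamN /le_trans; apply; exact/xle/ltnW.
Qed.

Theorem theorem2 (R : realType) (F : R -> R -> R)
    (F_pos : forall x y : R, 0 < x -> 0 < y -> 0 < F x y)
    (F_dec : decreasing2 F) (eps : R) (eps_pos : 0 < eps) :
  exists delta : R, 0 < delta /\
    forall (d : measure_display) (V : measurableType d) (mu : probability V R),
      separable_probability mu ->
      forall M : V * V -> R[i],
        kernel_operator mu M -> self_adjoint mu M -> (normoo mu M <= 1)%E ->
        exists (lambda : R) (S E Rem : V * V -> R[i]),
          [/\ delta <= lambda,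
              kernel_operator mu S, kernel_operator mu E,
              kernel_operator mu Rem &
              kernel_eq mu M (S \+ E \+ Rem)] /\
          [/\ is_spectral_truncation mu M lambda S,
              (norm2 mu E <= eps%:E)%E,
              (cut_norm mu Rem <= (F lambda eps)%:E)%E,
              (normoo mu (S \+ E)%R <= 1)%E &
              self_adjoint mu E /\ self_adjoint mu Rem].
Proof.
have [delta [delta0 H]] := bounded_regularity (fun x x0 => F_pos x eps x0 eps_pos) eps_pos.
exists delta; split=> // d V mu _ M kM sM M1.
have [A [bA sA A1 MA]] := hermitian_bounded_version kM sM M1.
have [lam [f es]] := bm_spectral_decomposition mu bA sA.
have [x [N [B [dx lamN [bB sB B1 BS AB]]]]] := H d V mu A lam f bA sA A1 es.
have bf i : bm (f i) by have [+ _ _ _] := es => /(_ i)[].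
pose S := trunc lam f x N; have bS : bm S by exact: bm_trunc.
have sS : kadj S = S by exact: kadj_trunc.
have bE : bm (fun z => B z - S z) by exact: bmB.
have bRem : bm (fun z => A z - B z) by exact: bmB.
(* [S + E] is then the average [B], bounded by 1, and the cut norm concerns [A - B]. *)
exists x, S, (fun z => B z - S z), (fun z => A z - B z).
split; split=> //; try exact: kernel_of_bm.
- by move: MA; apply: filterS => z ->; rewrite /= [S z + _]addrC subrK addrC subrK.
- apply: (truncation_of_eigensystem _ kM bA MA es lamN).
  exact: lt_le_trans delta0 dx.
- by rewrite norm2_bm// lee_fin.
- exact: cut_norm_le.
- apply/cnormoo_le; apply: aeW => z /=.
  by rewrite addrC subrK.
- by split; apply: self_adjoint_of_kadj; exact: kadjB.
Qed.
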